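(* Let $f$ be analytic on $\mathbb{D}$. Then for every positive integer $n$, \[ \frac{|f^{(n)}(0)|}{n!}\le \frac12\operatorname{Diam} f(\mathbb{D}). \] Moreover, equality holds for some $n$ if and only if $f(z)=f(0)+cz^n$ for some constant $c$ with $|c|=\operatorname{Diam} f(\mathbb{D})/2$.
   Context: $\mathbb{D}$ is the open unit disk; $\operatorname{Diam}E=\sup_{z,w\in E}|z-w|$ (possibly $+\infty$). *)

(* Defs.v *)
From HB Require Import structures.
From mathcomp Require Import all_boot all_order all_algebra complex.
From mathcomp Require Import all_classical all_reals all_analysis.
Import Order.TTheory GRing.Theory Num.Theory ComplexField ComplexField.Normc.
Import numFieldNormedType.Exports.
Local Open Scope ring_scope.
Local Open Scope classical_set_scope.

Set Implicit Arguments. Unset Strict Implicit. Unset Printing Implicit Defensive.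

(* The complex numbers R[i], seen as a numFieldType (hence a normed field /
   normed module over itself, so that complex derivatives make sense). *)
Definition Cplx (R : realType) : numFieldType := R[i].

Definition unit_disk (R : realType) : set (Cplx R) := [set z | normc z < 1].
Arguments unit_disk R : clear implicits.

(* f is analytic (= complex differentiable) at every point of the open set D:
   derivable f z 1 means the complex difference quotient
   (f (z + h) - f z) / h has a limit as h -> 0 in C. *)
Definition analytic_on (R : realType) (f : Cplx R -> Cplx R) (D : set (Cplx R)) :=
  forall z, D z -> derivable f z 1.

Definition nth_deriv (R : realType) (n : nat) (f : Cplx R -> Cplx R) (a : Cplx R)
  : Cplx R := derive1n n f a.

(* Diam E = sup_{z,w in E} |z - w|, an extended real (possibly +oo;
   -oo for the empty set, which never occurs below). *)
Definition Diam (R : realType) (E : set (Cplx R)) : \bar R :=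
  ereal_sup [set (normc (z - w))%:E | z in E & w in E].

(* Main.v *)
(* Let lam be an n-th root of -1. The function g z = f z - f (lam z) is bounded by
   Diam f(D) and has n-th coefficient 2 a_n, so the inequality is Cauchy's estimate
   for g. If it is an equality, Bessel's inequality for g gives a_k = 0 for 0 < k < n.
   For k > n, perturb lam to an n-th root of -e^(2is): then |g_n| = Diam * cos s, and
   testing g against the nonnegative weight 1 + Re (b z^(n-k)) gives
   |g_n| + |g_k| / 2 <= Diam, hence a_k (1 - lam^k) = O(s^2); since 1 - lam^k is either
   nonzero at s = 0 or of order s, a_k = 0.
   The needed function theory is obtained without contour integrals: Goursat's
   bisection argument gives a holomorphic function on the disk a primitive, which is
   C^1; for a C^1 holomorphic function, means over the N-th roots of unity satisfy
   Cauchy's formula in the limit N -> oo; differentiating this formula shows that the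
   derivative of a holomorphic function is holomorphic, and expanding it gives the
   Taylor coefficients. *)

Require Import Defs.
From HB Require Import structures.
From mathcomp Require Import all_boot all_order all_algebra complex.
From mathcomp Require Import all_classical all_reals all_analysis.
From mathcomp Require Import ring lra.
Import Order.TTheory GRing.Theory Num.Theory ComplexField ComplexField.Normc.
Import numFieldNormedType.Exports.
Local Open Scope ring_scope.
Local Open Scope classical_set_scope.
Set Implicit Arguments. Unset Strict Implicit. Unset Printing Implicit Defensive.

(** * Elementary inequalities for the complex modulus *)

Section Modulus.
Context {R : realType}.
Implicit Types (z w : R[i]) (x y : R).

(** For an n-th root [lam] of -1 the factor [1 - lam ^+ n] is 2, the largest possible modulus; this
    is the source of the half diameter. But with [lam = cis (pi / n)] also [lam ^+ k = 1] when k is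
    a multiple of 2n, and such a coefficient disappears from g: hence the perturbation. Bessel's
    inequality is then too weak. It bounds |a_k (1 - lam^k)| by Diam * sin s, of the same order in s
    as 1 - lam^k, and so only shows that a_k is bounded. The weighted estimate is linear in |g_k|
    and leaves Diam * (1 - cos s), one order better. Its weight has a second frequency, which picks
    up the coefficient of g of index 2n - k; for this reason the coefficients below n must be
    disposed of beforehand. On the analytic side, pointwise differentiability gives no control of
    increments that is uniform over the N nodes. A primitive has a continuous derivative, hence
    uniformly controlled increments, so Cauchy's formula is proved for the primitive and then passed
    on to f by differentiation. *)

Lemma normc_ge0 z : 0 <= normc z.
Proof. by case: z => x y; rewrite sqrtr_ge0. Qed.

Lemma normc_real x : normc x%:C%C = `|x|.
Proof. by rewrite /= expr0n addr0 sqrtr_sqr. Qed.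

Lemma normc_nat n : normc (n%:R : R[i]) = n%:R.
Proof. by rewrite -(rmorph_nat (real_complex R)) normc_real normr_nat. Qed.

Lemma normc_i : normc ('i%C : R[i]) = 1.
Proof. by rewrite /= expr0n add0r expr1n sqrtr1. Qed.

Lemma normc_sqr z : normc z ^+ 2 = complex.Re z ^+ 2 + complex.Im z ^+ 2.
Proof. by case: z => x y; rewrite sqr_sqrtr// addr_ge0// sqr_ge0. Qed.

Lemma normcX z n : normc (z ^+ n) = normc z ^+ n.
Proof. by elim: n => [|n IH]; rewrite ?normc1// !exprS normcM IH. Qed.

Lemma normc_eq0 z : (normc z == 0) = (z == 0).
Proof. by apply/eqP/eqP => [/eq0_normc//|->]; rewrite normc0. Qed.

Lemma normc_gt0 z : (0 < normc z) = (z != 0).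
Proof. by rewrite lt_def normc_ge0 andbT normc_eq0. Qed.

Lemma normcBC z w : normc (z - w) = normc (w - z).
Proof. by rewrite -normcN opprB. Qed.

Lemma le_normcB z w : normc (z - w) <= normc z + normc w.
Proof. by rewrite -(normcN w); exact: le_normcD. Qed.

Lemma le_normc_dist w z z' : normc (z - z') <= normc (z - w) + normc (w - z').
Proof. by rewrite -[X in normc X](subrKA w); exact: le_normcD. Qed.

Lemma lerB_normc z w : normc z - normc w <= normc (z - w).
Proof. by rewrite lerBlDr -{1}[z](subrK w) le_normcD. Qed.

Lemma le_normc_sum (I : Type) (s : seq I) (F : I -> R[i]) :
  normc (\sum_(i <- s) F i) <= \sum_(i <- s) normc (F i).
Proof.
elim/big_rec2: _ => [|i y z _ h]; first by rewrite normc0.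
by rewrite (le_trans (le_normcD _ _))// lerD2l.
Qed.

Lemma normc_Re z : `|complex.Re z| <= normc z.
Proof.
rewrite -(ler_pXn2r (isT : (0 < 2)%N)) ?nnegrE ?normc_ge0//.
by rewrite normc_sqr real_normK ?num_real// lerDl sqr_ge0.
Qed.

Lemma normc_Im z : `|complex.Im z| <= normc z.
Proof.
rewrite -(ler_pXn2r (isT : (0 < 2)%N)) ?nnegrE ?normc_ge0//.
by rewrite normc_sqr real_normK ?num_real// lerDr sqr_ge0.
Qed.

Lemma complexE z : z = (complex.Re z)%:C%C + 'i%C * (complex.Im z)%:C%C.
Proof. by case: z => x y; simpc. Qed.

Lemma Re_rect x y : complex.Re (x%:C%C + 'i%C * y%:C%C) = x.
Proof. by rewrite /= !(mul0r, mul1r, subr0, addr0). Qed.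

Lemma Im_rect x y : complex.Im (x%:C%C + 'i%C * y%:C%C) = y.
Proof. by rewrite /= !(mul0r, mul1r, addr0, add0r). Qed.

Lemma ReB z w : complex.Re (z - w) = complex.Re z - complex.Re w.
Proof. exact: raddfB. Qed.

Lemma ImB z w : complex.Im (z - w) = complex.Im z - complex.Im w.
Proof. exact: raddfB. Qed.

Lemma normc_le_ReIm z : normc z <= `|complex.Re z| + `|complex.Im z|.
Proof.
rewrite {1}[z]complexE (le_trans (le_normcD _ _))//.
by rewrite normcM normc_i mul1r !normc_real.
Qed.

(** Keeps the rectangle with opposite corners 0 and [x + i y] inside every disk around 0 that
    contains the second corner. *)
Lemma normc_rect_le x y t s : 0 <= t <= 1 -> 0 <= s <= 1 ->
  normc ((t * x)%:C%C + 'i%C * (s * y)%:C%C) <= normc (x%:C%C + 'i%C * y%:C%C).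
Proof.
move=> /andP[t0 t1] /andP[s0 s1].
rewrite -(ler_pXn2r (isT : (0 < 2)%N)) ?nnegrE ?normc_ge0// !normc_sqr !Re_rect !Im_rect.
have h (u v : R) : 0 <= u -> u <= 1 -> (u * v) ^+ 2 <= v ^+ 2.
  by move=> u0 u1; rewrite exprMn; apply: ler_piMl; [exact: sqr_ge0|exact: exprn_ile1].
by rewrite lerD// h.
Qed.

Lemma le_normc_mean n (F : nat -> R[i]) (B : R) :
  (forall j, (j < n.+1)%N -> normc (F j) <= B) ->
  normc (n.+1%:R^-1 * \sum_(0 <= j < n.+1) F j) <= B.
Proof.
move=> FB; rewrite normcM normcV normc_nat mulrC ler_pdivrMr ?ltr0n//.
apply: le_trans (le_normc_sum _ _) _.
have -> : B * n.+1%:R = \sum_(0 <= j < n.+1) B.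
  by rewrite sumr_const_nat subn0 mulr_natr.
by apply: ler_sum_nat => j /andP[_ jn]; exact: FB.
Qed.

End Modulus.

(** * Dyadic subdivision of the unit square *)

Section Cousin.
Context {R : realType}.

Lemma nested_intervals (a s : nat -> R) : (forall n, 0 <= s n) ->
  (forall n, a n <= a n.+1 /\ a n.+1 + s n.+1 <= a n + s n) ->
  exists p, forall n, a n <= p <= a n + s n.
Proof.
move=> s0 h.
have mono m k : a m <= a (m + k)%N /\ a (m + k)%N + s (m + k)%N <= a m + s m.
  elim: k => [|k [IH1 IH2]]; first by rewrite addn0.
  by rewrite addnS; have [h1 h2] := h (m + k)%N; split; [exact: le_trans IH1 h1|exact: le_trans h2 IH2].
have ub n : ubound (range a) (a n + s n).
  move=> _ [m _ <-]; have [mn|/ltnW nm] := leqP m n.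
    have [] := mono m (n - m)%N; rewrite subnKC// => h1 _.
    by rewrite (le_trans h1)// lerDl.
  have [] := mono n (m - n)%N; rewrite subnKC// => _; apply: le_trans.
  by rewrite lerDl.
have hs : has_sup (range a) by split; [exists (a 0%N); exists 0%N|exists (a 0%N + s 0%N); exact: ub].
exists (sup (range a)) => n; apply/andP; split.
  by apply: ub_le_sup; [case: hs|exists n].
by apply: ge_sup => //; case: hs.
Qed.

Lemma exists_half_expn_lt (d : R) : 0 < d -> exists n, 2^-1 ^+ n < d.
Proof.
move=> d0; have : (fun n => (2^-1 : R) ^+ n) @ \oo --> (0 : R).
  by apply: cvg_expr; rewrite ger0_norm; lra.
move=> /cvgrPdist_lt /(_ d d0) [n _ /(_ n (leqnn n))] /=.
by rewrite sub0r normrN ger0_norm ?exprn_ge0 ?invr_ge0// => ?; exists n.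
Qed.

(* Cousin's lemma for dyadic subdivisions. *)
Lemma unit_square_subdivision (Q : R -> R -> R -> Prop) :
  (forall p q, 0 <= p <= 1 -> 0 <= q <= 1 -> exists2 d, 0 < d &
    forall a b s, 0 < s < d -> 0 <= a -> a + s <= 1 -> 0 <= b -> b + s <= 1 ->
      a <= p <= a + s -> b <= q <= b + s -> Q a b s) ->
  (forall a b s, 0 < s -> Q a b (s / 2) -> Q (a + s / 2) b (s / 2) ->
     Q a (b + s / 2) (s / 2) -> Q (a + s / 2) (b + s / 2) (s / 2) -> Q a b s) ->
  Q 0 0 1.
Proof.
move=> Qloc Qsplit; apply: contrapT => nQ.
have /choice[st stP] (x : R * R * R) : exists y : R * R * R,
    0 < x.2 -> ~ Q x.1.1 x.1.2 x.2 ->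
    [/\ y.2 = x.2 / 2, ~ Q y.1.1 y.1.2 y.2,
        y.1.1 = x.1.1 \/ y.1.1 = x.1.1 + x.2 / 2 &
        y.1.2 = x.1.2 \/ y.1.2 = x.1.2 + x.2 / 2].
  case: x => [[a b] s] /=; apply: contrapT => no.
  (* A dummy witness: it only releases the hypotheses [s0] and [nQx], after which [Qsplit] and the
     four quarters give the contradiction. *)
  apply: (no); exists (0, 0, 0) => s0 nQx; case: nQx; apply: Qsplit => //;
    apply: contrapT => nQ'; apply: no.
  - by exists (a, b, s / 2) => _ _; split=> //=; left.
  - by exists (a + s / 2, b, s / 2) => _ _; split=> //=; [right|left].
  - by exists (a, b + s / 2, s / 2) => _ _; split=> //=; [left|right].
  - by exists (a + s / 2, b + s / 2, s / 2) => _ _; split=> //=; right.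
pose u n := iter n st (0, 0, 1).
have us n : (u n).2 = 2^-1 ^+ n /\ ~ Q (u n).1.1 (u n).1.2 (u n).2.
  elim: n => [|n [IH1 IH2]]; first by rewrite expr0.
  have p : 0 < (u n).2 by rewrite IH1 exprn_gt0// invr_gt0.
  by have [e1 e2 _ _] := stP (u n) p IH2; split=> //; rewrite exprSr -IH1.
have sp n : 0 < (u n).2 by rewrite (us n).1 exprn_gt0// invr_gt0.
have step n := stP (u n) (sp n) (us n).2.
have [p pP] : exists p, forall n, (u n).1.1 <= p <= (u n).1.1 + (u n).2.
  apply: nested_intervals => n; first exact: ltW.
  have /= := sp n; have [] := step n; rewrite -/(u n.+1) => -> _ [->|->] _; lra.
have [q qP] : exists q, forall n, (u n).1.2 <= q <= (u n).1.2 + (u n).2.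
  apply: nested_intervals => n; first exact: ltW.
  have /= := sp n; have [] := step n; rewrite -/(u n.+1) => -> _ _ [->|->]; lra.
have bnd n : [/\ 0 <= (u n).1.1, (u n).1.1 + (u n).2 <= 1, 0 <= (u n).1.2 &
                 (u n).1.2 + (u n).2 <= 1].
  elim: n => [|n [h1 h2 h3 h4]]; first by split=> /=; lra.
  have := sp n; have [] := step n; rewrite -/(u n.+1) => -> _ [->|->] [->|->] ?; split; lra.
have [d d0 dP] : exists2 d, 0 < d & forall a b s, 0 < s < d -> 0 <= a ->
    a + s <= 1 -> 0 <= b -> b + s <= 1 -> a <= p <= a + s -> b <= q <= b + s -> Q a b s.
  by apply: Qloc; [have := pP 0%N|have := qP 0%N]; rewrite /= add0r.
have [n nd] := exists_half_expn_lt d0.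
have [? ? ? ?] := bnd n.
by apply: (us n).2; apply: dP => //; rewrite sp (us n).1.
Qed.

Lemma le_epsM (x y b : R) : 0 <= b ->
  (forall e, 0 < e -> x <= y + e * b) -> x <= y.
Proof.
move=> b0 h; apply/ler_addgt0Pr => e e0.
have b1 : 0 < b + 1 by rewrite ltr_wpDl.
apply: (le_trans (h _ (divr_gt0 e0 b1))).
by rewrite lerD2l -mulrA ger_pMr// ler_pdivrMl// mulr1 lerDl.
Qed.

End Cousin.

(** * Real and complex derivatives in epsilon form; the mean value inequality *)

Section Derivatives.
Context {R : realType}.
Implicit Types (f g : R[i] -> R[i]) (phi psi : R -> R[i]).

(** The difference quotient is multiplied out, so the base point needs no exclusion, and errors are
    measured by real numbers, whereas the norm of [Cplx R] takes its values in the complex field. *)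
Definition rderiv phi (t : R) (l : R[i]) := forall e, 0 < e ->
  exists2 d, 0 < d & forall s, `|s - t| < d ->
  normc (phi s - phi t - (s - t)%:C%C * l) <= e * `|s - t|.

Definition cderiv f (z l : R[i]) := forall e, 0 < e ->
  exists2 d, 0 < d & forall w, normc (w - z) < d ->
  normc (f w - f z - (w - z) * l) <= e * normc (w - z).

Definition ccont f (z : R[i]) := forall e, 0 < e ->
  exists2 d, 0 < d & forall w, normc (w - z) < d -> normc (f w - f z) <= e.

Lemma rderivD phi psi t l m : rderiv phi t l -> rderiv psi t m ->
  rderiv (fun s => phi s + psi s) t (l + m).
Proof.
move=> hl hm e e0; have e2 : 0 < e / 2 by lra.
have [d1 d10 h1] := hl _ e2; have [d2 d20 h2] := hm _ e2.
exists (Num.min d1 d2); first by rewrite lt_min d10.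
move=> s; rewrite lt_min => /andP[/h1 s1 /h2 s2].
rewrite [X in normc X](_ : _ = (phi s - phi t - (s - t)%:C%C * l) +
  (psi s - psi t - (s - t)%:C%C * m)); last by ring.
by apply: le_trans (le_normcD _ _) _; lra.
Qed.

Lemma rderivZ phi t l (c : R[i]) : rderiv phi t l ->
  rderiv (fun s => c * phi s) t (c * l).
Proof.
move=> hl e e0; have c0 : 0 < normc c + 1 by rewrite ltr_wpDl// normc_ge0.
have [d d0 h] := hl _ (divr_gt0 e0 c0); exists d => // s /h hs.
rewrite [X in normc X](_ : _ = c * (phi s - phi t - (s - t)%:C%C * l)); last by ring.
rewrite normcM; apply: le_trans (ler_wpM2l (normc_ge0 _) hs) _.
rewrite mulrA ler_wpM2r// mulrCA ger_pMr// ler_pdivrMr// mul1r lerDl//.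
Qed.

Lemma rderivB phi psi t l m : rderiv phi t l -> rderiv psi t m ->
  rderiv (fun s => phi s - psi s) t (l - m).
Proof.
move=> hl /(rderivZ (-1)) hm; rewrite -mulN1r.
by under eq_fun do rewrite -mulN1r; exact: rderivD.
Qed.

Lemma rderiv_sum n (phi : nat -> R -> R[i]) t (l : nat -> R[i]) :
  (forall j, (j < n)%N -> rderiv (phi j) t (l j)) ->
  rderiv (fun s => \sum_(0 <= j < n) phi j s) t (\sum_(0 <= j < n) l j).
Proof.
elim: n => [_|n IH h].
  rewrite big_geq//; under eq_fun do rewrite big_geq//.
  by move=> e e0; exists 1 => // s _; rewrite mulr0 !subr0 normc0 mulr_ge0// ltW.
rewrite big_nat_recr//=; under eq_fun do rewrite big_nat_recr//=.
by apply: rderivD; [apply: IH => j jn; apply: h; exact: ltnW|exact: h].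
Qed.

Lemma cderiv_affine f (p v : R[i]) t l : cderiv f (p + t%:C%C * v) l ->
  rderiv (fun s => f (p + s%:C%C * v)) t (v * l).
Proof.
move=> hl e e0; have v0 : 0 < normc v + 1 by rewrite ltr_wpDl// normc_ge0.
have [d d0 h] := hl _ (divr_gt0 e0 v0); exists (d / (normc v + 1)).
  exact: divr_gt0.
move=> s; rewrite ltr_pdivlMr// => sd.
have E : p + s%:C%C * v - (p + t%:C%C * v) = (s - t)%:C%C * v.
  by rewrite rmorphB; ring.
have := h (p + s%:C%C * v); rewrite E [normc (_ * v)]normcM normc_real.
rewrite -mulrA => {}h; apply: le_trans (h _) _.
  by apply: le_lt_trans sd; rewrite ler_wpM2l// lerDl.
rewrite mulrCA mulrC ler_wpM2r// -mulrA ger_pMr// mulrC ler_pdivrMr//.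
by rewrite mul1r lerDl.
Qed.

Lemma cderiv_cont f z l : cderiv f z l -> ccont f z.
Proof.
move=> h e e0; have [d d0 {}h] := h 1 ltr01.
have l0 : 0 < normc l + 1 by rewrite ltr_wpDl// normc_ge0.
exists (Num.min d (e / (normc l + 1))); first by rewrite lt_min d0 divr_gt0.
move=> w; rewrite lt_min ltr_pdivlMr// => /andP[/h hw we].
have := le_normcD (f w - f z - (w - z) * l) ((w - z) * l).
rewrite subrK normcM; lra.
Qed.

(** The bound with [M + e] holds on short intervals around each point and adds up over adjacent
    intervals, so subdivision gives it on the whole segment. Writing points as [a + t * (b - a)]
    makes the order of [a] and [b] immaterial. *)
Lemma mean_value_ineq (phi dphi : R -> R[i]) (a b M : R) :
  (forall t, 0 <= t <= 1 -> normc (dphi (a + t * (b - a))) <= M) ->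
  (forall t, 0 <= t <= 1 -> rderiv phi (a + t * (b - a)) (dphi (a + t * (b - a)))) ->
  normc (phi b - phi a) <= M * `|b - a|.
Proof.
move=> dM dphiP; apply: (@le_epsM _ _ _ `|b - a|) => // e e0.
pose g t := a + t * (b - a).
(* Being constant in [v], this predicate turns the subdivision of the square into one of the
   interval. *)
pose Q (u v s : R) := normc (phi (g (u + s)) - phi (g u)) <= (M + e) * `|b - a| * s.
suff : Q 0 0 1.
  by rewrite /Q /g add0r mulr1 mul0r mul1r addr0 (addrC a) subrK mulrDl.
apply: (unit_square_subdivision (Q := Q)) => [p q p01 _|u v s s0]; last first.
  rewrite /Q => h1 h2 _ _.
  have -> : u + s = u + s / 2 + s / 2 by field.
  apply: le_trans (le_normc_dist (phi (g (u + s / 2))) _ _) _.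
  by apply: le_trans (lerD h2 h1) _; rewrite -mulrDr -splitr.
have ba : 0 < `|b - a| + 1 by rewrite ltr_wpDl.
have [d d0 dP] := dphiP p p01 e e0; have {}dM := dM p p01.
exists (d / (`|b - a| + 1)); first exact: divr_gt0.
move=> u v s /andP[s0]; rewrite ltr_pdivlMr// => sd u0 u1 _ _ /andP[up pu] _.
rewrite /Q -/(g p) in dM dP *.
have hu t : `|t - p| <= s -> normc (phi (g t) - phi (g p) - (g t - g p)%:C%C * dphi (g p))
    <= e * (`|t - p| * `|b - a|).
  move=> ts; have -> : `|t - p| * `|b - a| = `|g t - g p|.
    by rewrite -normrM; congr `|_|; rewrite /g; ring.
  apply: dP; rewrite (_ : g t - g p = (t - p) * (b - a)); last by rewrite /g; ring.
  rewrite normrM; apply: le_lt_trans sd; apply: ler_pM => //; lra.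
have h1 := hu u; have h2 := hu (u + s).
have e1 : `|u - p| = p - u by rewrite ler0_norm; lra.
have e2 : `|u + s - p| = u + s - p by rewrite ger0_norm; lra.
rewrite e1 in h1; rewrite e2 in h2.
have {}h1 := h1 ltac:(lra); have {}h2 := h2 ltac:(lra).
(* Both ends are compared with the point [p] between them: the errors, proportional to [p - u] and
   [u + s - p], add up to a multiple of [s]. *)
have -> : phi (g (u + s)) - phi (g u) = (phi (g (u + s)) - phi (g p) - (g (u + s) - g p)%:C%C * dphi (g p))
    - (phi (g u) - phi (g p) - (g u - g p)%:C%C * dphi (g p)) + (s * (b - a))%:C%C * dphi (g p).
  have -> : s * (b - a) = g (u + s) - g u by rewrite /g; ring.
  by rewrite !rmorphB; ring.
apply: le_trans (le_normcD _ _) _.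
have h3 : normc ((s * (b - a))%:C%C * dphi (g p)) <= s * `|b - a| * M.
  by rewrite normcM normc_real normrM (gtr0_norm s0) ler_wpM2l// mulr_ge0// ltW.
apply: le_trans (lerD (le_normcB _ _) h3) _.
apply: le_trans (lerD (lerD h2 h1) (lexx _)) _.
rewrite le_eqVlt; apply/orP; left; apply/eqP; ring.
Qed.

End Derivatives.

(** * Library derivatives and their epsilon form *)

Section Bridge.

Lemma derivable_eps (K : numFieldType) (f : K -> K) (x e : K) :
  derivable f x 1 -> 0 < e -> exists2 d, 0 < d & forall w, `|w - x| < d ->
  `|f w - f x - (w - x) * derive1 f x| <= e * `|w - x|.
Proof.
move=> df e0.
have : h^-1 *: (f (h + x) - f x) @[h --> 0^'] --> derive1 f x.
  move: df; rewrite /derivable /derive1.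
  by under eq_fun do rewrite [_ *: 1]mulr1.
move=> /cvgrPdist_le /(_ e e0) => -[d /= d0 hd].
exists d => // w wd; have [->|wx] := eqVneq w x.
  by rewrite !subrr mul0r subr0 normr0 mulr0.
have wx0 : w - x != 0 by rewrite subr_eq0.
have := hd (w - x); rewrite /= sub0r normrN => /(_ wd wx0).
rewrite subrK => h.
rewrite (_ : f w - f x - _ = - ((derive1 f x - (w - x)^-1 *: (f w - f x)) * (w - x))).
  by rewrite normrN normrM ler_wpM2r.
by rewrite -[_ *: _]/((w - x)^-1 * (f w - f x)); field.
Qed.

Lemma eps_derivable (K : numFieldType) (f : K -> K) (x l : K) :
  (forall e, 0 < e -> exists2 d, 0 < d & forall w, `|w - x| < d ->
    `|f w - f x - (w - x) * l| <= e * `|w - x|) ->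
  derivable f x 1 /\ derive1 f x = l.
Proof.
move=> h.
have H : h^-1 *: (f (h + x) - f x) @[h --> 0^'] --> l.
  apply/cvgrPdist_le => e e0.
  have [d d0 hd] := h e e0; exists d => // w; rewrite /= sub0r normrN => wd w0.
  have := hd (w + x); rewrite addrK => /(_ wd).
  rewrite -ler_pdivrMr ?normr_gt0// -normfV -normrM; congr (_ <= _).
  rewrite distrC; congr `|_|.
  by rewrite -[_ *: _]/(w^-1 * (f (w + x) - f x)); field.
split; last by rewrite /derive1; apply/cvg_lim.
apply/cvg_ex; exists l; move: H.
by under [in X in _ -> X]eq_fun do rewrite [_ *: 1]mulr1.
Qed.

End Bridge.

(** * Primitives of continuous functions of a real variable *)

Section Primitives.
Context {R : realType}.
Implicit Types (f g : R[i] -> R[i]) (phi psi : R -> R[i]).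

(** The Lebesgue integral enters here only, through the fundamental theorem of calculus for a
    continuous integrand. *)
Lemma continuous_real_primitive (h : R -> R) (a b : R) : continuous h ->
  exists H : R -> R, forall x, a < x < b -> forall e, 0 < e ->
  exists2 d, 0 < d & forall s, `|s - x| < d ->
    `|H s - H x - (s - x) * h x| <= e * `|s - x|.
Proof.
move=> ch; pose H x := (\int[lebesgue_measure]_(t in [set` `[a, x]]) h t)%R.
exists H => x /andP[ax xb] e e0.
have ih : lebesgue_measure.-integrable `[a, b] (EFin \o h).
  apply: continuous_compact_integrable; first exact: segment_compact.
  exact: continuous_subspaceT.
have [dH H'] := continuous_FTC1_closed xb ih ax (ch x).
by have := derivable_eps dH e0; rewrite H'.
Qed.

Lemma continuous_primitive phi (a b : R) :
  (forall t e, 0 < e -> exists2 d, 0 < d & forall s, `|s - t| < d ->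
     normc (phi s - phi t) <= e) ->
  exists Phi, forall t, a < t < b -> rderiv Phi t (phi t).
Proof.
move=> cphi.
have cRe : continuous (fun t => complex.Re (phi t)).
  move=> t; apply/cvgrPdist_le => e e0; have [d d0 dP] := cphi t e e0.
  exists d => // s /=; rewrite distrC => /dP; apply: le_trans.
  by rewrite distrC -raddfB normc_Re.
have cIm : continuous (fun t => complex.Im (phi t)).
  move=> t; apply/cvgrPdist_le => e e0; have [d d0 dP] := cphi t e e0.
  exists d => // s /=; rewrite distrC => /dP; apply: le_trans.
  by rewrite distrC -raddfB normc_Im.
have [U UP] := continuous_real_primitive a b cRe.
have [V VP] := continuous_real_primitive a b cIm.
exists (fun t => (U t +i* V t)%C) => t abt e e0; have e2 : 0 < e / 2 by lra.
have [d1 d10 h1] := UP t abt _ e2; have [d2 d20 h2] := VP t abt _ e2.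
exists (Num.min d1 d2); first by rewrite lt_min d10.
move=> s; rewrite lt_min => /andP[/h1 s1 /h2 s2].
apply: le_trans (normc_le_ReIm _) _.
case: (phi t) s1 s2 => u v /=.
by rewrite !(mul0r, subr0, addr0, add0r); lra.
Qed.

End Primitives.

(** * Goursat's theorem for rectangles *)

Section Goursat.
Context {R : realType}.
Variables (f : R[i] -> R[i]) (rho : R).
Hypothesis rho1 : rho <= 1.
Hypothesis fD : forall z, normc z < rho -> exists l, cderiv f z l.
Variables X Y : R -> R -> R[i].

Local Notation pt x y := (x%:C%C + 'i%C * y%:C%C).

Hypothesis XP : forall y (t : R), -2 < t < 2 -> rderiv (X y) t (f (pt t y)).
Hypothesis YP : forall x (t : R), -2 < t < 2 -> rderiv (Y x) t (f (pt x t)).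

(** The counterclockwise boundary integral of [f] (bottom, right, top, left), read off from the
    primitives [X y] along horizontal and [Y x] along vertical lines. *)
Definition rect_integral (x x' y y' : R) :=
  (X y x' - X y x) + 'i%C * (Y x' y' - Y x' y) - (X y' x' - X y' x)
  - 'i%C * (Y x y' - Y x y).

Lemma pt_lt2 (x y : R) : normc (pt x y) < rho -> (-2 < x < 2) && (-2 < y < 2).
Proof.
move=> h; have r2 : rho <= 2 by apply: le_trans rho1 _; rewrite ler1n.
have hx : `|x| < 2.
  apply: le_lt_trans (lt_le_trans h r2).
  by rewrite -{1}[x](Re_rect x y) normc_Re.
have hy : `|y| < 2.
  apply: le_lt_trans (lt_le_trans h r2).
  by rewrite -{1}[y](Im_rect x y) normc_Im.
by rewrite -!ltr_norml hx.
Qed.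

(* On a small rectangle f is nearly affine, and an affine function has the
   primitive L, whose increments along the closed boundary cancel. *)
Lemma small_rect_integral (P l : R[i]) (e d x x' y y' : R) : 0 < e ->
  (forall w, normc (w - P) < d -> normc (f w - f P - (w - P) * l) <= e * normc (w - P)) ->
  (forall t s : R, 0 <= t <= 1 -> 0 <= s <= 1 ->
     normc (pt (x + t * (x' - x)) (y + s * (y' - y))) < rho) ->
  (forall t s : R, 0 <= t <= 1 -> 0 <= s <= 1 ->
     normc (pt (x + t * (x' - x)) (y + s * (y' - y)) - P) <= `|x' - x| + `|y' - y|) ->
  `|x' - x| + `|y' - y| < d ->
  normc (rect_integral x x' y y') <= 2 * e * (`|x' - x| + `|y' - y|) ^+ 2.
Proof.
move=> e0 hP hin hd hsm; set D := `|x' - x| + `|y' - y| in hd hsm *.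
pose L z := f P * z + l * (z - P) ^+ 2 / 2.
have LD (z : R[i]) : cderiv L z (f P + (z - P) * l).
  move=> e1 e10; exists (e1 / (normc l + 1)).
    by rewrite divr_gt0// ltr_wpDl// normc_ge0.
  move=> w; rewrite ltr_pdivlMr ?ltr_wpDl ?normc_ge0// => hw.
  rewrite (_ : _ - _ = (w - z) * ((w - z) * (l / 2))); last by rewrite /L; field.
  rewrite normcM mulrC ler_wpM2r ?normc_ge0// normcM.
  have : normc (l / 2) <= normc l + 1.
    rewrite normcM normcV normc_nat; have := normc_ge0 l; lra.
  by move=> /(ler_wpM2l (normc_ge0 (w - z))); lra.
have near (w : R[i]) : normc (w - P) <= D -> normc (f w - (f P + (w - P) * l)) <= e * D.
  move=> wD; rewrite opprD addrA; apply: le_trans (hP _ _) _.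
    exact: le_lt_trans wD hsm.
  by rewrite ler_wpM2l// ltW.
have hor (c s : R) : c = y + s * (y' - y) -> 0 <= s <= 1 ->
    normc (X c x' - X c x - (L (pt x' c) - L (pt x c))) <= e * D * `|x' - x|.
  move=> cE s01.
  rewrite (_ : _ - _ = (X c x' - L (pt x' c)) - (X c x - L (pt x c))); last by ring.
  apply: (mean_value_ineq (phi := fun t => X c t - L (pt t c))
    (dphi := fun t => f (pt t c) - (f P + (pt t c - P) * l))) => t t01.
    by rewrite cE; apply: near; apply: hd.
  apply: rderivB; first by apply: XP; have /andP[] := pt_lt2 (hin t s t01 s01).
  have := @cderiv_affine _ L ('i%C * c%:C%C) 1 (x + t * (x' - x)) _ (LD _).
  rewrite mulr1 mul1r ['i%C * _ + _]addrC.
  by under eq_fun do rewrite mulr1 addrC.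
have ver (c s : R) : c = x + s * (x' - x) -> 0 <= s <= 1 ->
    normc ('i%C * (Y c y' - Y c y) - (L (pt c y') - L (pt c y))) <= e * D * `|y' - y|.
  move=> cE s01.
  rewrite (_ : _ - _ = ('i%C * Y c y' - L (pt c y')) - ('i%C * Y c y - L (pt c y))); last by ring.
  apply: (mean_value_ineq (phi := fun t => 'i%C * Y c t - L (pt c t))
    (dphi := fun t => 'i%C * f (pt c t) - 'i%C * (f P + (pt c t - P) * l))) => t t01.
    by rewrite -mulrBr normcM normc_i mul1r cE; apply: near; apply: hd.
  apply: rderivB.
    by apply: rderivZ; apply: YP; have /andP[] := pt_lt2 (hin s t s01 t01).
  have := @cderiv_affine _ L (c%:C%C) 'i%C (y + t * (y' - y)) _ (LD _).
  rewrite (mulrC _%:C%C 'i%C).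
  by under eq_fun do rewrite (mulrC _%:C%C 'i%C).
have i0 : 0 <= (0 : R) <= 1 by lra. have i1 : 0 <= (1 : R) <= 1 by lra.
have E0 (u v : R) : u = u + 0 * (v - u) by ring.
have E1 (u v : R) : v = u + 1 * (v - u) by ring.
have h1 := hor _ _ (E0 y y') i0; have h2 := hor _ _ (E1 y y') i1.
have h3 := ver _ _ (E0 x x') i0; have h4 := ver _ _ (E1 x x') i1.
set A1 := _ - _ in h1; set A2 := _ - _ in h2; set A3 := _ - _ in h3; set A4 := _ - _ in h4.
have -> : rect_integral x x' y y' = (A1 + A4) - (A2 + A3).
  by rewrite /rect_integral /A1 /A2 /A3 /A4; ring.
apply: le_trans (le_normcB _ _) _.
apply: le_trans (lerD (le_normcD _ _) (le_normcD _ _)) _.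
apply: le_trans (lerD (lerD h1 h4) (lerD h2 h3)) _.
by rewrite le_eqVlt; apply/orP; left; apply/eqP; rewrite /D; ring.
Qed.

(** The bound [e * (2 * D ^+ 2) * s ^+ 2] scales like the area, so four quarters add up to exactly
    the bound for the whole, inner edges cancelling; on small squares it is the estimate from
    differentiability. Then [e] tends to 0. *)
Lemma rect_integral_eq0 (x y : R) : normc (pt x y) < rho -> rect_integral 0 x 0 y = 0.
Proof.
move=> hxy; apply/eqP; rewrite -normc_eq0 eq_le normc_ge0 andbT.
pose D := `|x| + `|y|; have D0 : 0 <= D by rewrite addr_ge0.
apply: (@le_epsM _ _ _ (2 * D ^+ 2)); first by rewrite mulr_ge0// sqr_ge0.
move=> e e0; rewrite add0r.
pose Q (a b s : R) := normc (rect_integral (a * x) ((a + s) * x) (b * y) ((b + s) * y))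
  <= e * (2 * D ^+ 2) * s ^+ 2.
suff : Q 0 0 1 by rewrite /Q add0r !mul0r !mul1r expr1n mulr1.
apply: (unit_square_subdivision (Q := Q)) => [p q p01 q01|a b s s0]; last first.
  rewrite /Q -!addrA -!splitr => h1 h2 h3 h4.
  set m := a + s / 2; set k := b + s / 2.
  have -> : rect_integral (a * x) ((a + s) * x) (b * y) ((b + s) * y) =
    (rect_integral (a * x) (m * x) (b * y) (k * y) +
     rect_integral (m * x) ((a + s) * x) (b * y) (k * y)) +
    (rect_integral (a * x) (m * x) (k * y) ((b + s) * y) +
     rect_integral (m * x) ((a + s) * x) (k * y) ((b + s) * y)).
    by rewrite /rect_integral; ring.
  apply: le_trans (le_normcD _ _) _.
  apply: le_trans (lerD (le_normcD _ _) (le_normcD _ _)) _.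
  apply: le_trans (lerD (lerD h1 h2) (lerD h3 h4)) _.
  by rewrite le_eqVlt; apply/orP; left; apply/eqP; field.
have inD (t s : R) : 0 <= t <= 1 -> 0 <= s <= 1 -> normc (pt (t * x) (s * y)) < rho.
  by move=> t01 s01; apply: le_lt_trans (normc_rect_le _ _ t01 s01) hxy.
have [l lP] := fD (inD p q p01 q01); have [d d0 dP] := lP e e0.
exists (d / (D + 1)); first by rewrite divr_gt0// ltr_wpDl.
move=> a b s /andP[s0]; rewrite ltr_pdivlMr ?ltr_wpDl// => sd a0 a1 b0 b1 ap bq.
have E1 : (a + s) * x - a * x = s * x by ring.
have E2 : (b + s) * y - b * y = s * y by ring.
have N : `|s * x| + `|s * y| = s * D by rewrite !normrM (gtr0_norm s0) -mulrDr.
have E (t u c : R) : c * u + t * (s * u) = (c + t * s) * u by ring.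
rewrite /Q; have := @small_rect_integral (pt (p * x) (q * y)) l e d
  (a * x) ((a + s) * x) (b * y) ((b + s) * y) e0 dP.
rewrite E1 E2 N (_ : e * _ * _ = 2 * e * (s * D) ^+ 2); last by ring.
apply.
- move=> t u t01 u01; rewrite !E; apply: inD; nra.
- move=> t u t01 u01; rewrite !E.
  rewrite (_ : _ - _ = pt ((a + t * s - p) * x) ((b + u * s - q) * y)); last first.
    by rewrite !(rmorphM, rmorphB, rmorphD); ring.
  apply: le_trans (le_normcD _ _) _.
  rewrite normcM normc_i mul1r !normc_real !normrM mulrDr.
  by apply: lerD; apply: ler_wpM2r => //; rewrite ler_norml; nra.
- by apply: le_lt_trans sd; rewrite ler_wpM2l ?(ltW s0)// lerDl.
Qed.

End Goursat.

(** * Compactness of closed disks; primitives of holomorphic functions *)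

Section DiskCompactness.
Context {R : realType}.
Implicit Types (f g : R[i] -> R[i]) (z w : R[i]) (r e : R).

(** The radial retraction onto the closed disk of radius [r]; composing with it extends a function
    continuous on the disk to one continuous on the plane. *)
Definition clamp r z : R[i] := z * (r / Num.max r (normc z))%:C%C.

Lemma clamp_id r z : 0 < r -> normc z <= r -> clamp r z = z.
Proof.
by move=> r0 /max_idPl zr; rewrite /clamp zr divff ?gt_eqF// mulr1.
Qed.

Lemma clamp_le r z : 0 < r -> normc (clamp r z) <= r.
Proof.
move=> r0; have m0 : 0 < Num.max r (normc z) by rewrite lt_max r0.
rewrite /clamp normcM normc_real ger0_norm ?divr_ge0 ?(ltW r0) ?(ltW m0)//.
by rewrite mulrA ler_pdivrMr// mulrC ler_pM2l// le_max lexx orbT.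
Qed.

(** One unit of the constant pays for moving the point at a fixed scale, the other for the change of
    scale, governed by [Num.max r (normc z)]. *)
Lemma clamp_lipschitz r z w : 0 < r ->
  normc (clamp r w - clamp r z) <= 2 * normc (w - z).
Proof.
move=> r0; rewrite /clamp; set mw := Num.max r (normc w); set mz := Num.max r (normc z).
have mw0 : 0 < mw by rewrite lt_max r0.
have mz0 : 0 < mz by rewrite lt_max r0.
have rw : r <= mw by rewrite le_max lexx.
have zm : normc z <= mz by rewrite le_max lexx orbT.
have d : `|mz - mw| <= normc (w - z).
  have h1 := lerB_normc w z; have h2 := lerB_normc z w; rewrite normcBC in h2.
  rewrite ler_norml /mz /mw; case: (leP r (normc z)); case: (leP r (normc w)); lra.
rewrite (_ : _ - _ = (w - z) * (r / mw)%:C%C + z * (r / mw - r / mz)%:C%C); last first.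
  by rewrite rmorphB; ring.
apply: le_trans (le_normcD _ _) _.
rewrite mulr_natl mulr2n !normcM !normc_real.
have u0 : 0 <= r / mw by rewrite divr_ge0// ltW.
have u1 : r / mw <= 1 by rewrite ler_pdivrMr// mul1r.
have v0 : 0 <= normc z / mz by rewrite divr_ge0 ?normc_ge0// ltW.
have v1 : normc z / mz <= 1 by rewrite ler_pdivrMr// mul1r.
apply: lerD; first by apply: ler_piMr; rewrite ?normc_ge0// ger0_norm.
have -> : r / mw - r / mz = (r / mw) * mz^-1 * (mz - mw) by field; rewrite !gt_eqF.
rewrite 2!normrM (ger0_norm u0) [`|mz^-1|]ger0_norm ?invr_ge0 ?(ltW mz0)//.
rewrite [X in X <= _](_ : _ = (r / mw) * (normc z / mz) * `|mz - mw|); last by ring.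
apply: le_trans d; apply: ler_piMl => //.
exact: mulr_ile1.
Qed.

Lemma ccont_clamp f r : 0 < r -> (forall z, normc z <= r -> ccont f z) ->
  forall z, ccont (f \o clamp r) z.
Proof.
move=> r0 fC z e e0; have [d d0 dP] := fC _ (clamp_le z r0) _ e0.
exists (d / 2) => [|w wz /=]; first by lra.
by apply: dP; apply: le_lt_trans (clamp_lipschitz _ _ r0) _; lra.
Qed.

Lemma square_coord z : normc z <= 1 -> exists p q : R,
  [/\ 0 <= p <= 1, 0 <= q <= 1, complex.Re z = 2 * p - 1 & complex.Im z = 2 * q - 1].
Proof.
move=> z1; have := le_trans (normc_Re z) z1; have := le_trans (normc_Im z) z1.
rewrite !ler_norml => hy hx.
exists ((complex.Re z + 1) / 2), ((complex.Im z + 1) / 2); split; lra.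
Qed.

(** Heine-Cantor by subdivision: moduli valid on four quarters have a minimum valid on the square,
    and near a point continuity there supplies one. *)
Lemma unif_ccont f e : 0 < e -> (forall z, ccont f z) ->
  exists2 d, 0 < d & forall z w, normc z <= 1 -> normc (w - z) < d ->
  normc (f w - f z) <= e.
Proof.
move=> e0 fC.
pose Q (a b s : R) := exists2 d, 0 < d & forall (p q : R) z w,
  a <= p <= a + s -> b <= q <= b + s ->
  complex.Re z = 2 * p - 1 -> complex.Im z = 2 * q - 1 ->
  normc (w - z) < d -> normc (f w - f z) <= e.
suff [d d0 dP] : Q 0 0 1.
  exists d => // z w /square_coord[p [q [p01 q01 zp zq]]].
  by apply: dP zp zq; rewrite add0r.
apply: (unit_square_subdivision (Q := Q)) => [p q _ _|a b s s0]; last first.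
  move=> [d1 d10 h1] [d2 d20 h2] [d3 d30 h3] [d4 d40 h4].
  exists (Num.min (Num.min d1 d2) (Num.min d3 d4)); first by rewrite !lt_min d10 d20 d30.
  move=> p q z w ap bq zp zq; rewrite !lt_min => /andP[/andP[w1 w2] /andP[w3 w4]].
  have [pa|pa] := leP p (a + s / 2); have [qb|qb] := leP q (b + s / 2).
  - by apply: h1 zp zq w1; lra.
  - by apply: h3 zp zq w3; lra.
  - by apply: h2 zp zq w2; lra.
  - by apply: h4 zp zq w4; lra.
pose c : R[i] := (2 * p - 1)%:C%C + 'i%C * (2 * q - 1)%:C%C.
have e2 : 0 < e / 2 by lra.
(* The coordinates [2 * p - 1] double lengths, so points of a square of side [s < d / 8] lie within
   [4 * s < d / 2] of [c]. *)
have [d d0 dP] := fC c _ e2; exists (d / 8); first by lra.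
move=> a b s sd _ _ _ _ ap bq; exists (d / 2); first by lra.
move=> p' q' z w ap' bq' zp zq wz.
have zc : normc (z - c) < d / 2.
  apply: le_lt_trans (normc_le_ReIm _) _; rewrite ReB ImB Re_rect Im_rect zp zq.
  have hp : `|2 * p' - 1 - (2 * p - 1)| <= 2 * s by rewrite ler_norml; lra.
  have hq : `|2 * q' - 1 - (2 * q - 1)| <= 2 * s by rewrite ler_norml; lra.
  lra.
have h1 : normc (f z - f c) <= e / 2 by apply: dP; lra.
have h2 : normc (f w - f c) <= e / 2.
  by apply: dP; have := le_normc_dist z w c; lra.
by have := le_normc_dist (f c) (f w) (f z); rewrite (normcBC (f c)); lra.
Qed.

Lemma ccont_bounded f : (forall z, ccont f z) ->
  exists2 M, 0 <= M & forall z, normc z <= 1 -> normc (f z) <= M.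
Proof.
move=> fC; pose Q (a b s : R) := exists2 M, 0 <= M & forall (p q : R) z,
  a <= p <= a + s -> b <= q <= b + s ->
  complex.Re z = 2 * p - 1 -> complex.Im z = 2 * q - 1 -> normc (f z) <= M.
suff [M M0 MP] : Q 0 0 1.
  exists M => // z /square_coord[p [q [p01 q01 zp zq]]].
  by apply: MP zp zq; rewrite add0r.
apply: (unit_square_subdivision (Q := Q)) => [p q p01 q01|a b s s0]; last first.
  move=> [M1 M10 h1] [M2 M20 h2] [M3 M30 h3] [M4 M40 h4].
  exists (M1 + M2 + (M3 + M4)); first by rewrite !addr_ge0.
  move=> p q z ap bq zp zq.
  have [pa|pa] := leP p (a + s / 2); have [qb|qb] := leP q (b + s / 2).
  - by apply: le_trans (h1 _ _ _ _ _ zp zq) _; lra.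
  - by apply: le_trans (h3 _ _ _ _ _ zp zq) _; lra.
  - by apply: le_trans (h2 _ _ _ _ _ zp zq) _; lra.
  - by apply: le_trans (h4 _ _ _ _ _ zp zq) _; lra.
pose c : R[i] := (2 * p - 1)%:C%C + 'i%C * (2 * q - 1)%:C%C.
have [d' d'0 dP'] := fC c _ ltr01; exists (d' / 8); first by lra.
move=> a b s sd _ _ _ _ ap bq; exists (normc (f c) + 1).
  by rewrite addr_ge0 ?normc_ge0.
move=> p' q' z ap' bq' zp zq.
have zc : normc (z - c) < d'.
  apply: le_lt_trans (normc_le_ReIm _) _; rewrite ReB ImB Re_rect Im_rect zp zq.
  have hp : `|2 * p' - 1 - (2 * p - 1)| <= 2 * s by rewrite ler_norml; lra.
  have hq : `|2 * q' - 1 - (2 * q - 1)| <= 2 * s by rewrite ler_norml; lra.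
  lra.
by have := lerB_normc (f z) (f c); have := dP' _ zc; lra.
Qed.

Lemma disk_unif_ccont f r e : 0 < r <= 1 -> 0 < e ->
  (forall z, normc z <= r -> ccont f z) ->
  exists2 d, 0 < d & forall z w, normc z <= r -> normc w <= r ->
    normc (w - z) < d -> normc (f w - f z) <= e.
Proof.
move=> /andP[r0 r1] e0 /(ccont_clamp r0) /(unif_ccont e0)[d d0 dP].
exists d => // z w zr wr /(dP _ _ (le_trans zr r1)) /=.
by rewrite !clamp_id.
Qed.

Lemma disk_ccont_bounded f r : 0 < r <= 1 ->
  (forall z, normc z <= r -> ccont f z) ->
  exists2 M, 0 <= M & forall z, normc z <= r -> normc (f z) <= M.
Proof.
move=> /andP[r0 r1] /(ccont_clamp r0) /ccont_bounded[M M0 MP].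
by exists M => // z zr; have := MP z (le_trans zr r1); rewrite /= clamp_id.
Qed.

(** [G] integrates from 0 horizontally, then vertically; by Goursat, [GE] takes the other order.
    Vertical increments are visible in the first form, horizontal ones in the second. Continuity on
    the plane provides primitives along whole segments, even where these leave the disk. *)
Lemma entire_ccont_primitive f rho : rho <= 1 -> (forall z, ccont f z) ->
  (forall z, normc z < rho -> exists l, cderiv f z l) ->
  exists F, forall z, normc z < rho -> cderiv F z (f z).
Proof.
move=> rho1 fC fD.
have /choice[X XP] (y : R) : exists Xy : R -> R[i], forall t : R, -2 < t < 2 ->
    rderiv Xy t (f (t%:C%C + 'i%C * y%:C%C)).
  apply: continuous_primitive => t e e0.
  have [d d0 dP] := fC (t%:C%C + 'i%C * y%:C%C) e e0; exists d => // s sd.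
  apply: dP; rewrite (_ : _ - _ = (s - t)%:C%C) ?normc_real//.
  by rewrite rmorphB; ring.
have /choice[Y YP] (x : R) : exists Yx : R -> R[i], forall t : R, -2 < t < 2 ->
    rderiv Yx t (f (x%:C%C + 'i%C * t%:C%C)).
  apply: continuous_primitive => t e e0.
  have [d d0 dP] := fC (x%:C%C + 'i%C * t%:C%C) e e0; exists d => // s sd.
  apply: dP; rewrite (_ : _ - _ = 'i%C * (s - t)%:C%C); last by rewrite rmorphB; ring.
  by rewrite normcM normc_i mul1r normc_real.
pose G (x y : R) := X 0 x - X 0 0 + 'i%C * (Y x y - Y x 0).
have GE (x y : R) : normc (x%:C%C + 'i%C * y%:C%C) < rho ->
    G x y = 'i%C * (Y 0 y - Y 0 0) + (X y x - X y 0).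
  move=> /(rect_integral_eq0 rho1 fD XP YP); rewrite /rect_integral => h.
  by apply/eqP; rewrite -subr_eq0 -h /G; apply/eqP; ring.
exists (fun z => G (complex.Re z) (complex.Im z)) => z zr e e0.
have e2 : 0 < e / 2 by lra.
have [d d0 dP] := fC z _ e2.
(* All points of the path from [z] to [w] through the corner [(x, y')] lie within
   [2 * normc (w - z)] of [z], which explains both halves. *)
exists (Num.min (d / 2) ((rho - normc z) / 2)).
  by rewrite lt_min; apply/andP; split; lra.
move=> w; rewrite lt_min => /andP[wd wr].
set x := complex.Re z; set y := complex.Im z; set x' := complex.Re w; set y' := complex.Im w.
have dx : `|x' - x| <= normc (w - z) by rewrite -ReB normc_Re.
have dy : `|y' - y| <= normc (w - z) by rewrite -ImB normc_Im.
have near (a b : R) : `|a - x| <= normc (w - z) -> `|b - y| <= normc (w - z) ->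
    normc (a%:C%C + 'i%C * b%:C%C - z) <= 2 * normc (w - z).
  move=> ha hb; apply: le_trans (normc_le_ReIm _) _.
  by rewrite ReB ImB Re_rect Im_rect -/x -/y; lra.
have nearR (a b : R) : `|a - x| <= normc (w - z) -> `|b - y| <= normc (w - z) ->
    normc (a%:C%C + 'i%C * b%:C%C) < rho.
  move=> ha hb; have := near a b ha hb.
  by have := lerB_normc (a%:C%C + 'i%C * b%:C%C) z; lra.
have t0 : `|x - x| <= normc (w - z) by rewrite subrr normr0 normc_ge0.
have t0' : `|y - y| <= normc (w - z) by rewrite subrr normr0 normc_ge0.
have between (u u' t m : R) : 0 <= t <= 1 -> `|u' - u| <= m -> `|u + t * (u' - u) - u| <= m.
  move=> /andP[t1 t2] h; rewrite addrC addKr normrM (ger0_norm t1).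
  by apply: le_trans h; apply: ler_piMl.
have A : normc (X y' x' - X y' x - (x' - x)%:C%C * f z) <= e / 2 * `|x' - x|.
  rewrite (_ : _ - _ = (X y' x' - x'%:C%C * f z) - (X y' x - x%:C%C * f z)); last first.
    by rewrite rmorphB; ring.
  apply: (mean_value_ineq (phi := fun t => X y' t - t%:C%C * f z)
    (dphi := fun t => f (t%:C%C + 'i%C * y'%:C%C) - f z)) => t t01.
    by apply: dP; have := near _ y' (between _ _ _ _ t01 dx) dy; lra.
  apply: rderivB.
    by apply: XP; have /andP[] := pt_lt2 rho1 (nearR _ y' (between _ _ _ _ t01 dx) dy).
  move=> e1 e10; exists 1 => // s _.
  rewrite [X in normc X](_ : _ = 0) ?normc0 ?mulr_ge0 ?(ltW e10)//.
  by rewrite rmorphB; ring.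
have B : normc (Y x y' - Y x y - (y' - y)%:C%C * f z) <= e / 2 * `|y' - y|.
  rewrite (_ : _ - _ = (Y x y' - y'%:C%C * f z) - (Y x y - y%:C%C * f z)); last first.
    by rewrite rmorphB; ring.
  apply: (mean_value_ineq (phi := fun t => Y x t - t%:C%C * f z)
    (dphi := fun t => f (x%:C%C + 'i%C * t%:C%C) - f z)) => t t01.
    by apply: dP; have := near x _ t0 (between _ _ _ _ t01 dy); lra.
  apply: rderivB.
    by apply: YP; have /andP[] := pt_lt2 rho1 (nearR x _ t0 (between _ _ _ _ t01 dy)).
  move=> e1 e10; exists 1 => // s _.
  rewrite [X in normc X](_ : _ = 0) ?normc0 ?mulr_ge0 ?(ltW e10)//.
  by rewrite rmorphB; ring.
have -> : G x' y' - G x y - (w - z) * f z =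
    (X y' x' - X y' x - (x' - x)%:C%C * f z) +
    'i%C * (Y x y' - Y x y - (y' - y)%:C%C * f z).
  rewrite (_ : _ - G x y = (G x' y' - G x y') + (G x y' - G x y)); last by ring.
  rewrite (GE x' y') ?nearR// {1}(GE x y') ?nearR//.
  rewrite [w]complexE [z]complexE -/x -/y -/x' -/y' /G !rmorphB; ring.
apply: le_trans (le_normcD _ _) _; rewrite normcM normc_i mul1r.
by have := ler_wpM2l (ltW e2) dx; have := ler_wpM2l (ltW e2) dy; lra.
Qed.

Lemma holomorphic_primitive f rho r : 0 < r -> r < rho -> rho <= 1 ->
  (forall z, normc z < rho -> exists l, cderiv f z l) ->
  exists F, forall z, normc z < r -> cderiv F z (f z).
Proof.
move=> r0 rr r1 fD.
have fC z : normc z <= r -> ccont f z.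
  by move=> zr; have [|l /cderiv_cont//] := fD z; exact: le_lt_trans rr.
have [||F FP] := @entire_ccont_primitive (f \o clamp r) r _ (ccont_clamp r0 fC).
- exact: le_trans (ltW rr) r1.
- move=> z zr; have [|l lP] := fD z; first exact: lt_trans rr.
  exists l => e e0; have [d d0 dP] := lP e e0.
  exists (Num.min d (r - normc z)); first by rewrite lt_min d0 subr_gt0.
  move=> w; rewrite lt_min => /andP[/dP wd wr] /=.
  rewrite !clamp_id//; first exact: ltW.
  by have := lerB_normc w z; lra.
by exists F => z zr; have := FP z zr; rewrite /= clamp_id// ltW.
Qed.

End DiskCompactness.

(** * Points of the unit circle and roots of unity *)

Section Cis.
Context {R : realType}.
Implicit Types (s t : R).

Definition cis t : R[i] := (cos t +i* sin t)%C.

Lemma cisD s t : cis (s + t) = cis s * cis t.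
Proof. by rewrite /cis cosD sinD; simpc; congr (_ +i* _)%C; ring. Qed.

Lemma cis0 : cis 0 = 1.
Proof. by rewrite /cis cos0 sin0. Qed.

Lemma cisX t n : cis t ^+ n = cis (t *+ n).
Proof. by elim: n => [|n IH]; rewrite ?cis0// exprS IH mulrS cisD. Qed.

Lemma normc_cis t : normc (cis t) = 1.
Proof. by rewrite /= cos2Dsin2 sqrtr1. Qed.

Lemma cis_neq0 t : cis t != 0.
Proof. by rewrite -normc_gt0 normc_cis. Qed.

Lemma cispi : cis pi = -1.
Proof. by rewrite /cis cospi sinpi; apply/eqP; rewrite eq_complex /= oppr0 !eqxx. Qed.

Lemma cis2pi : cis (pi *+ 2) = 1.
Proof. by rewrite -cisX cispi sqrrN expr1n. Qed.

Lemma normc_cisB1 t : normc (cis (t *+ 2) - 1) = 2 * `|sin t|.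
Proof.
apply/eqP; rewrite -(eqrXn2 (isT : (0 < 2)%N)) ?normc_ge0 ?mulr_ge0//.
rewrite normc_sqr ReB ImB exprMn real_normK ?num_real//=.
rewrite cos_mulr2n sin_mulr2n subr0.
have -> : ((cos t * sin t) *+ 2) ^+ 2 = 4 * cos t ^+ 2 * sin t ^+ 2 by ring.
by rewrite cos2sin2; apply/eqP; ring.
Qed.

Lemma normc_cisD1 t : normc (1 + cis (t *+ 2)) = 2 * `|cos t|.
Proof.
apply/eqP; rewrite -(eqrXn2 (isT : (0 < 2)%N)) ?normc_ge0 ?mulr_ge0//.
rewrite normc_sqr exprMn real_normK ?num_real//=.
rewrite cos_mulr2n sin_mulr2n add0r.
have -> : ((cos t * sin t) *+ 2) ^+ 2 = 4 * cos t ^+ 2 * sin t ^+ 2 by ring.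
by rewrite sin2cos2; apply/eqP; ring.
Qed.

Lemma cis_neq1 t : 0 < t < pi *+ 2 -> cis t != 1.
Proof.
move=> t0; rewrite -subr_eq0 -normc_gt0 (_ : t = (t / 2) *+ 2); last by field.
rewrite normc_cisB1 mulr_gt0// normr_gt0 gt_eqF// sin_gt0_pi//; lra.
Qed.

Lemma cis_near1 (e : R) : 0 < e -> exists2 d : R, 0 < d & forall t, `|t| < d ->
  normc (cis t - 1) <= e.
Proof.
move=> e0; have : {for 0, continuous (@sin R)} by exact: continuous_sin.
have e2 : 0 < e / 2 by lra.
move=> /cvgrPdist_le /(_ _ e2)[d d0 dP]; exists d => // t td.
have h : `|sin (t / 2)| <= e / 2.
  have := dP (t / 2); rewrite /= sin0 !sub0r !normrN; apply.
  by rewrite normrM normfV (ger0_norm (ler0n _ _)); have := normr_ge0 t; lra.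
rewrite [t](_ : _ = (t / 2) *+ 2) ?normc_cisB1; last by field.
lra.
Qed.

(** The order is [n.+1], so that the number of nodes is never 0. *)
Definition unity_root n : R[i] := cis ((pi *+ 2) / n.+1%:R).

Lemma unity_rootX n : unity_root n ^+ n.+1 = 1.
Proof. by rewrite cisX -[_ *+ n.+1]mulr_natr divfK ?cis2pi// pnatr_eq0. Qed.

Lemma unity_rootX_neq1 n k : (0 < k < n.+1)%N -> unity_root n ^+ k != 1.
Proof.
move=> /andP[k0 kn]; rewrite cisX cis_neq1//.
have p := pi_gt0 R; have q : (0 : R) < pi *+ 2 by rewrite mulrn_wgt0.
rewrite -[_ *+ k]mulr_natr mulr_gt0 ?divr_gt0 ?ltr0n//=.
by rewrite mulrAC ltr_pdivrMr ?ltr0n// ltr_pM2l// ltr_nat.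
Qed.

Lemma normc_unity_rootX n j : normc (unity_root n ^+ j) = 1.
Proof. by rewrite normcX normc_cis expr1n. Qed.

Lemma unity_root_neq0 n : unity_root n != 0.
Proof. exact: cis_neq0. Qed.

Lemma sum_unity_root n k : (0 < k < n.+1)%N ->
  \sum_(0 <= j < n.+1) (unity_root n ^+ k) ^+ j = 0.
Proof.
move=> kn; have := subrX1 (unity_root n ^+ k) n.+1.
rewrite exprAC unity_rootX expr1n subrr big_mkord => /esym/eqP.
by rewrite mulf_eq0 subr_eq0 (negPf (unity_rootX_neq1 kn)) => /eqP.
Qed.

Lemma unity_root_near1 (e : R) : 0 < e -> exists n0, forall n, (n0 <= n)%N ->
  normc (unity_root n - 1) <= e.
Proof.
move=> e0; have [d d0 dP] := cis_near1 e0.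
have p : (0 : R) < pi *+ 2 by rewrite mulrn_wgt0// pi_gt0.
have [n0 n0P] : exists n0 : nat, pi *+ 2 / d < n0%:R.
  exists (Num.bound (pi *+ 2 / d)); apply: archi_boundP.
  by rewrite divr_ge0// ltW.
exists n0 => n n0n; apply: dP; rewrite gtr0_norm ?divr_gt0 ?ltr0n//.
rewrite ltr_pdivrMr ?ltr0n// mulrC -ltr_pdivrMr// (lt_le_trans n0P)// ler_nat.
exact: leqW.
Qed.

End Cis.

(** * Limits of complex sequences *)

Section Limits.
Context {R : realType}.
Implicit Types (u v : nat -> R[i]) (l m : R[i]).

Definition lims u l := forall e : R, 0 < e -> exists n0, forall n, (n0 <= n)%N ->
  normc (u n - l) <= e.

Lemma lims_cst l : lims (fun=> l) l.
Proof. by move=> e e0; exists 0%N => n _; rewrite subrr normc0 ltW. Qed.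

Lemma eq_lims u v l n1 : (forall n, (n1 <= n)%N -> u n = v n) -> lims u l -> lims v l.
Proof.
move=> uv ul e e0; have [n0 n0P] := ul e e0; exists (maxn n0 n1) => n.
by rewrite geq_max => /andP[h1 h2]; rewrite -uv// n0P.
Qed.

Lemma limsD u v l m : lims u l -> lims v m -> lims (fun n => u n + v n) (l + m).
Proof.
move=> ul vm e e0; have e2 : 0 < e / 2 by lra.
have [n0 h0] := ul _ e2; have [n1 h1] := vm _ e2.
exists (maxn n0 n1) => n; rewrite geq_max => /andP[/h0 {}h0 /h1 {}h1].
rewrite opprD addrACA; apply: le_trans (le_normcD _ _) _; lra.
Qed.

Lemma lims_mul0 u v (B : R) : (forall n, normc (v n) <= B) -> lims u 0 ->
  lims (fun n => v n * u n) 0.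
Proof.
move=> vB ul e e0; have B0 : 0 < B + 1.
  by rewrite ltr_wpDl//; apply: le_trans (vB 0%N); exact: normc_ge0.
have [n0 n0P] := ul _ (divr_gt0 e0 B0); exists n0 => n /n0P; rewrite !subr0 normcM.
rewrite ler_pdivlMr// mulrC; apply: le_trans; apply: ler_wpM2r; first exact: normc_ge0.
by apply: le_trans (vB n) _; rewrite lerDl.
Qed.

Lemma lims_sub0 u l : lims u l <-> lims (fun n => u n - l) 0.
Proof. by split=> h e e0; have [n0 n0P] := h e e0; exists n0 => n /n0P; rewrite subr0. Qed.

Lemma limsZ u l (c : R[i]) : lims u l -> lims (fun n => c * u n) (c * l).
Proof.
move=> /lims_sub0 h; apply/lims_sub0.
have := @lims_mul0 _ (fun=> c) (normc c) (fun=> lexx _) h.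
by apply: (@eq_lims _ _ _ 0%N) => n _; rewrite mulrBr.
Qed.

Lemma limsB u v l m : lims u l -> lims v m -> lims (fun n => u n - v n) (l - m).
Proof.
move=> ul /(limsZ (-1)) vm; have := limsD ul vm; rewrite mulN1r.
by apply: (@eq_lims _ _ _ 0%N) => n _; rewrite mulN1r.
Qed.

Lemma lims_sum (I : Type) (s : seq I) (u : I -> nat -> R[i]) (l : I -> R[i]) :
  (forall i, lims (u i) (l i)) -> lims (fun n => \sum_(i <- s) u i n) (\sum_(i <- s) l i).
Proof.
move=> h; elim: s => [|i s IH].
  by rewrite big_nil; apply: (@eq_lims _ _ _ 0%N) (lims_cst 0) => n _; rewrite big_nil.
rewrite big_cons; apply: (@eq_lims _ _ _ 0%N) (limsD (h i) IH) => n _.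
by rewrite big_cons.
Qed.

Lemma lims_norm_le u l (B : R) n1 : lims u l ->
  (forall n, (n1 <= n)%N -> normc (u n) <= B) -> normc l <= B.
Proof.
move=> ul uB; apply/ler_addgt0Pr => e e0; have [n0 n0P] := ul _ e0.
have h0 := n0P (maxn n0 n1) (leq_maxl _ _); have h1 := uB (maxn n0 n1) (leq_maxr _ _).
have := lerB_normc l (u (maxn n0 n1)); rewrite normcBC; lra.
Qed.

Lemma lims_unique u l m : lims u l -> lims u m -> l = m.
Proof.
move=> ul um; apply/eqP; rewrite -subr_eq0 -normc_eq0 eq_le normc_ge0 andbT.
apply: (lims_norm_le (limsB ul um) (n1 := 0%N)) => n _.
by rewrite subrr normc0.
Qed.

Lemma cauchy_lims u : (forall e : R, 0 < e -> exists n0, forall n k,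
  (n0 <= n)%N -> (n0 <= k)%N -> normc (u n - u k) <= e) -> exists l, lims u l.
Proof.
move=> uC.
have real_cauchy (v : nat -> R) : (forall n k, `|v n - v k| <= normc (u n - u k)) ->
    exists x : R, forall e : R, 0 < e -> exists n0, forall n, (n0 <= n)%N -> `|v n - x| <= e.
  move=> vu; have /cauchy_cvgP /cvg_ex[x /cvgrPdist_le xP] : cauchy (v @ \oo).
    apply/cauchy_ballP => e e0; have e2 : 0 < e / 2 by lra.
    have [n0 n0P] := uC _ e2.
    exists (v @` [set n | (n0 <= n)%N], v @` [set n | (n0 <= n)%N]) => /=.
      by split; exists n0 => // n hn; exists n.
    move=> [_ _] [[n hn <-] [k hk <-]].
    by apply: le_lt_trans (vu n k) _; have := n0P n k hn hk; lra.
  exists x => e e0; have [n0 _ n0P] := xP e e0; exists n0 => n hn.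
  by rewrite distrC; exact: n0P.
have [x xP] := real_cauchy (fun n => complex.Re (u n)) (fun n k =>
  eq_ind _ (fun t => `|t| <= _) (normc_Re (u n - u k)) _ (ReB _ _)).
have [y yP] := real_cauchy (fun n => complex.Im (u n)) (fun n k =>
  eq_ind _ (fun t => `|t| <= _) (normc_Im (u n - u k)) _ (ImB _ _)).
exists (x +i* y)%C => e e0; have e2 : 0 < e / 2 by lra.
have [n0 h0] := xP _ e2; have [n1 h1] := yP _ e2.
exists (maxn n0 n1) => n; rewrite geq_max => /andP[/h0 {}h0 /h1 {}h1].
apply: le_trans (normc_le_ReIm _) _; rewrite ReB ImB /=; lra.
Qed.

Lemma lims_expr0 (q : R) : 0 <= q < 1 -> forall e, 0 < e ->
  exists n0, forall n, (n0 <= n)%N -> q ^+ n <= e.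
Proof.
move=> /andP[q0 q1] e e0; have : (fun n => q ^+ n) @ \oo --> (0 : R).
  by apply: cvg_expr; rewrite ger0_norm.
move=> /cvgrPdist_le /(_ e e0)[n0 _ n0P]; exists n0 => n hn.
by have := n0P n hn; rewrite /= sub0r normrN ger0_norm// exprn_ge0.
Qed.

End Limits.

(** * Means over roots of unity and Cauchy's formula *)

Section CircleMean.
Context {R : realType}.
Implicit Types (f g h F : R[i] -> R[i]) (z w a : R[i]) (r rho e t : R).

Definition circle_pt n r j : R[i] := r%:C%C * unity_root n ^+ j.

(** The discrete counterpart of the average of [h] over the circle of radius [r]; all coefficient
    formulas are limits of such means. *)
Definition circle_mean n h r : R[i] :=
  n.+1%:R^-1 * \sum_(0 <= j < n.+1) h (circle_pt n r j).

Lemma normc_circle_pt n r j : 0 <= r -> normc (circle_pt n r j) = r.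
Proof. by move=> r0; rewrite normcM normc_unity_rootX mulr1 normc_real ger0_norm. Qed.

Lemma circle_ptS n r j : circle_pt n r j.+1 = circle_pt n r j * unity_root n.
Proof. by rewrite /circle_pt exprSr mulrA. Qed.

Lemma circle_ptN n r : circle_pt n r n.+1 = circle_pt n r 0.
Proof. by rewrite /circle_pt unity_rootX. Qed.

Lemma natS_neq0 n : (n.+1%:R : R[i]) != 0.
Proof. by rewrite pnatr_eq0. Qed.

Lemma circle_mean_sum_shift n r h :
  \sum_(0 <= j < n.+1) h (circle_pt n r j.+1) = \sum_(0 <= j < n.+1) h (circle_pt n r j).
Proof. by rewrite big_nat_recr//= circle_ptN addrC [RHS]big_nat_recl//=. Qed.

Lemma eq_circle_mean n r g h : 0 <= r -> (forall z, normc z = r -> g z = h z) ->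
  circle_mean n g r = circle_mean n h r.
Proof.
move=> r0 gh; congr (_ * _); apply: eq_bigr => j _.
by rewrite gh// normc_circle_pt.
Qed.

Lemma circle_meanD n r g h :
  circle_mean n (fun z => g z + h z) r = circle_mean n g r + circle_mean n h r.
Proof. by rewrite /circle_mean big_split mulrDr. Qed.

Lemma circle_meanZ n r c h :
  circle_mean n (fun z => c * h z) r = c * circle_mean n h r.
Proof. by rewrite /circle_mean -big_distrr /= mulrCA. Qed.

Lemma circle_meanB n r g h :
  circle_mean n (fun z => g z - h z) r = circle_mean n g r - circle_mean n h r.
Proof. by rewrite /circle_mean sumrB mulrBr. Qed.

Lemma circle_mean_sum n r (I : Type) (s : seq I) (h : I -> R[i] -> R[i]) :
  circle_mean n (fun z => \sum_(i <- s) h i z) r = \sum_(i <- s) circle_mean n (h i) r.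
Proof. by rewrite /circle_mean exchange_big mulr_sumr. Qed.

Lemma circle_mean_cst n r c : circle_mean n (fun=> c) r = c.
Proof.
by rewrite /circle_mean sumr_const_nat subn0 -[c *+ _]mulr_natr mulrC mulfK ?natS_neq0.
Qed.

Lemma le_circle_mean n r h B : 0 <= r -> (forall z, normc z = r -> normc (h z) <= B) ->
  normc (circle_mean n h r) <= B.
Proof.
by move=> r0 hB; apply: le_normc_mean => j _; apply: hB; rewrite normc_circle_pt.
Qed.

Lemma circle_mean_expr n r k : (0 < k < n.+1)%N -> circle_mean n (fun z => z ^+ k) r = 0.
Proof.
move=> kn; rewrite /circle_mean (eq_bigr (fun j => r%:C%C ^+ k * (unity_root n ^+ k) ^+ j)).
  by rewrite -big_distrr /= sum_unity_root// !mulr0.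
by move=> j _; rewrite /circle_pt exprMn exprAC.
Qed.

Lemma circle_mean_exprV n r k : (0 < k < n.+1)%N -> circle_mean n (fun z => z ^- k) r = 0.
Proof.
move=> /andP[k0 kn]; have nkn : (0 < n.+1 - k < n.+1)%N.
  by rewrite subn_gt0 kn ltn_subrL k0.
(* At the nodes an inverse power is a positive one, since [om ^- k = om ^+ (n.+1 - k)] for the root
   [om] of order [n.+1]. *)
rewrite /circle_mean (eq_bigr (fun j => r%:C%C ^- k * (unity_root n ^+ (n.+1 - k)) ^+ j)).
  by rewrite -big_distrr /= sum_unity_root// !mulr0.
move=> j _; rewrite /circle_pt exprMn invfM; congr (_ * _).
have u0 : (unity_root n ^+ j) ^+ k != 0 :> R[i] by rewrite !expf_neq0// unity_root_neq0.
apply: (mulIf u0); rewrite mulVf// [(_ ^+ j) ^+ k]exprAC -exprMn -exprD subnK ?(ltnW kn)//.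
by rewrite unity_rootX expr1n.
Qed.

(** The finite geometric series of the Cauchy kernel; the numerator [z] is what [dz = i z dt] leaves
    when the integral becomes a mean. *)
Lemma geometric_expansion z a K : z != 0 -> z - a != 0 ->
  z / (z - a) = \sum_(0 <= i < K) a ^+ i / z ^+ i + a ^+ K / z ^+ K * (z / (z - a)).
Proof.
move=> z0 za; elim: K => [|K IH]; first by rewrite big_geq// add0r divr1 mul1r.
rewrite big_nat_recr//= {1}IH -addrA; congr (_ + _).
by rewrite !exprSr; field; rewrite z0 za expf_neq0.
Qed.

Lemma segment_normc_le z w r t : normc z <= r -> normc w <= r -> 0 <= t <= 1 ->
  normc (z + t%:C%C * (w - z)) <= r.
Proof.
move=> zr wr /andP[t0 t1].
rewrite (_ : _ + _ = (1 - t)%:C%C * z + t%:C%C * w); last by rewrite rmorphB rmorph1; ring.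
apply: le_trans (le_normcD _ _) _; rewrite !normcM !normc_real !ger0_norm ?subr_ge0//.
have : (1 - t) * normc z <= (1 - t) * r by rewrite ler_wpM2l// subr_ge0.
have : t * normc w <= t * r by rewrite ler_wpM2l.
lra.
Qed.

(** Continuity of the derivative makes differentiability uniform: along the segment from [z] to [w]
    the error has derivative [w - z] times an increment of [f], which uniform continuity makes
    small. *)
Lemma unif_cderiv F f rho r e : 0 < r -> r < rho -> r <= 1 -> 0 < e ->
  (forall z, normc z < rho -> cderiv F z (f z)) ->
  (forall z, normc z < rho -> ccont f z) ->
  exists2 d, 0 < d & forall z w, normc z <= r -> normc w <= r ->
    normc (w - z) < d -> normc (F w - F z - (w - z) * f z) <= e * normc (w - z).
Proof.
move=> r0 rr r1 e0 FD fC.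
have [||d d0 dP] := @disk_unif_ccont _ f r e _ e0; first by rewrite r0.
  by move=> z zr; apply: fC; exact: le_lt_trans rr.
exists d => // z w zr wr wd.
have E0 : z + 0%:C%C * (w - z) = z by rewrite rmorph0 mul0r addr0.
have E1 : z + 1%:C%C * (w - z) = w by rewrite rmorph1 mul1r addrC subrK.
pose phi t := F (z + t%:C%C * (w - z)) - t%:C%C * ((w - z) * f z).
have -> : F w - F z - (w - z) * f z = phi 1 - phi 0.
  by rewrite /phi E0 E1 rmorph0 rmorph1; ring.
have -> : e * normc (w - z) = e * normc (w - z) * `|1 - 0| by rewrite subr0 normr1 mulr1.
apply: (mean_value_ineq (dphi := fun t => (w - z) * f (z + t%:C%C * (w - z)) - (w - z) * f z)).
  move=> t t01; rewrite add0r subr0 mulr1 -mulrBr normcM mulrC ler_wpM2r ?normc_ge0//.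
  apply: dP => //; first exact: segment_normc_le.
  rewrite addrC addKr normcM normc_real; apply: le_lt_trans wd.
  by apply: ler_piMl; rewrite ?normc_ge0// ger0_norm; lra.
move=> t t01; rewrite add0r subr0 mulr1; apply: rderivB.
  by apply: cderiv_affine; apply: FD; apply: le_lt_trans rr; exact: segment_normc_le.
move=> e1 e10; exists 1 => // s _.
rewrite [X in normc X](_ : _ = 0) ?normc0 ?mulr_ge0 ?(ltW e10)//.
by rewrite rmorphB; ring.
Qed.

Lemma cauchy_kernel_bound z a r : normc a < r -> normc z = r ->
  [/\ z != 0, z - a != 0 & normc (z - a)^-1 <= (r - normc a)^-1].
Proof.
move=> ar zr; have ra : 0 < r - normc a by lra.
have h := lerB_normc z a; rewrite zr in h.
have za : 0 < normc (z - a) by exact: lt_le_trans h.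
split; first by rewrite -normc_gt0 zr; have := normc_ge0 a; lra.
- by rewrite -normc_gt0.
- by rewrite normcV lef_pV2.
Qed.

(** Among the powers [a ^+ i / z ^+ i] with [i <= n], the mean over [n.+1] nodes keeps only [i = 0];
    the remainder decays like [q ^+ n.+1]. *)
Lemma lims_cauchy_kernel r a : 0 < r -> normc a < r ->
  lims (fun n => circle_mean n (fun z => z / (z - a)) r) 1.
Proof.
move=> r0 ar; have ra : 0 < r - normc a by lra.
pose q := normc a / r.
have q01 : 0 <= q < 1.
  by rewrite divr_ge0 ?normc_ge0 ?(ltW r0)//= ltr_pdivrMr// mul1r.
pose B := r / (r - normc a); have B0 : 0 < B by rewrite divr_gt0.
move=> e e0; have [n0 n0P] := lims_expr0 q01 (divr_gt0 e0 B0).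
exists n0 => n hn.
have -> : circle_mean n (fun z => z / (z - a)) r - 1 =
    circle_mean n (fun z => a ^+ n.+1 / z ^+ n.+1 * (z / (z - a))) r.
  rewrite (@eq_circle_mean _ _ _ (fun z => \sum_(0 <= i < n.+1) a ^+ i / z ^+ i +
    a ^+ n.+1 / z ^+ n.+1 * (z / (z - a)))) ?(ltW r0)//; last first.
    by move=> z /(cauchy_kernel_bound ar)[z0 za _]; exact: geometric_expansion.
  rewrite circle_meanD circle_mean_sum big_nat_recl//= big_nat big1.
    rewrite addr0 (_ : (fun z => _) = fun=> 1).
      by rewrite circle_mean_cst addrC addKr.
    by apply/funext => z; rewrite !expr0 divr1.
  by move=> i ni; rewrite circle_meanZ circle_mean_exprV ?mulr0//.
apply: le_circle_mean; first exact: ltW.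
move=> z zr; have [_ _ zb] := cauchy_kernel_bound ar zr.
rewrite 3!normcM normcV !normcX zr -expr_div_n -/q.
have h : r * normc (z - a)^-1 <= B by rewrite /B ler_pM2l.
have hq := n0P n.+1 (leqW hn); rewrite ler_pdivlMr// in hq.
apply: le_trans hq; apply: ler_wpM2l => //.
by rewrite exprn_ge0//; case/andP: q01.
Qed.

(* Discrete Cauchy formula. The mean over the roots of unity of
   F(a + t (z - a)) z / (z - a) has t-derivative (mean of z F'(a + t (z - a))),
   which up to o(1) telescopes around the polygon of the points a + t (z - a). *)
Lemma cauchy_mean F f rho r a : 0 < r -> r < rho -> r <= 1 -> normc a < r ->
  (forall z, normc z < rho -> cderiv F z (f z)) ->
  (forall z, normc z < rho -> ccont f z) ->
  lims (fun n => circle_mean n (fun z => F z * (z / (z - a))) r) (F a).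
Proof.
move=> r0 rr r1 ar FD fC.
suff H : lims (fun n => circle_mean n (fun z => F z * (z / (z - a))) r -
    F a * circle_mean n (fun z => z / (z - a)) r) 0.
  have := limsD H (limsZ (F a) (lims_cauchy_kernel r0 ar)).
  rewrite add0r mulr1; apply: (@eq_lims _ _ _ _ 0%N) => n _.
  by rewrite subrK.
(* The tolerance [e / r] absorbs the factor [r] in the length [t * normc (om - 1) * r] of the
   polygon's sides. *)
move=> e e0; have [d d0 dP] := unif_cderiv r0 rr r1 (divr_gt0 e0 r0) FD fC.
have d2 : 0 < d / 2 by lra.
have [n0 n0P] := @unity_root_near1 R _ d2.
(* For [n >= 1] the root [om] differs from 1 and the mean of [z] over the nodes vanishes. *)
exists (maxn n0 1) => n; rewrite geq_max => /andP[/n0P hom n1]; rewrite subr0.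
set om := unity_root n in hom; pose zj j := circle_pt n r j.
have zr j : normc (zj j) = r by rewrite normc_circle_pt// ltW.
pose w t j := a + t%:C%C * (zj j - a).
have wr t j : 0 <= t <= 1 -> normc (w t j) <= r.
  by move=> t01; apply: segment_normc_le => //; [exact: ltW|rewrite zr].
pose phi t := n.+1%:R^-1 * \sum_(0 <= j < n.+1) (zj j / (zj j - a)) * F (w t j).
have -> : circle_mean n (fun z => F z * (z / (z - a))) r -
    F a * circle_mean n (fun z => z / (z - a)) r = phi 1 - phi 0.
  congr (_ - _).
    congr (_ * _); apply: eq_bigr => j _.
    by rewrite mulrC; congr (_ * F _); rewrite /w rmorph1 mul1r addrC subrK.
  rewrite /phi /circle_mean mulrCA mulr_sumr; congr (_ * _); apply: eq_bigr => j _.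
  by rewrite mulrC /w rmorph0 mul0r addr0.
have -> : e = e * `|1 - 0 : R| by rewrite subr0 normr1 mulr1.
apply: (mean_value_ineq (dphi := fun t => n.+1%:R^-1 *
    \sum_(0 <= j < n.+1) (zj j / (zj j - a)) * ((zj j - a) * f (w t j)))); last first.
  move=> t t01; rewrite add0r subr0 mulr1; apply: rderivZ; apply: rderiv_sum => j _.
  apply: rderivZ; apply: cderiv_affine; apply: FD.
  by apply: le_lt_trans rr; exact: wr.
move=> t t01; rewrite add0r subr0 mulr1.
rewrite (eq_bigr (fun j => zj j * f (w t j))); last first.
  move=> j _; have [_ za _] := cauchy_kernel_bound ar (zr j).
  by rewrite mulrA divfK.
(* At [t = 0] the polygon collapses to the point [a] and the factor [t] cannot be cancelled; there
   the sum is [f a] times the vanishing sum of the nodes. *)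
have [t0|tn0] := eqVneq t 0.
  rewrite (eq_bigr (fun j => f a * zj j ^+ 1)); last first.
    by move=> j _; rewrite /w t0 rmorph0 mul0r addr0 mulrC.
  rewrite -big_distrr mulrCA -[n.+1%:R^-1 * _]/(circle_mean n (fun z => z ^+ 1) r).
  by rewrite circle_mean_expr ?ltnS// mulr0 normc0 ltW.
have tp : 0 < t by rewrite lt_def tn0; case/andP: t01.
have om1 : om - 1 != 0.
  by rewrite subr_eq0 -[om]expr1 unity_rootX_neq1.
pose D := \sum_(0 <= j < n.+1) zj j * f (w t j).
have wS j : w t j.+1 - w t j = t%:C%C * (om - 1) * zj j.
  by rewrite /w /zj circle_ptS -/om; ring.
have wSn j : normc (w t j.+1 - w t j) = t * normc (om - 1) * r.
  by rewrite wS 2!normcM zr normc_real gtr0_norm.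
have tel : \sum_(0 <= j < n.+1) (F (w t j.+1) - F (w t j)) = 0.
  by rewrite telescope_sumr// /w /zj circle_ptN subrr.
have E : t%:C%C * (om - 1) * (n.+1%:R^-1 * D) = n.+1%:R^-1 *
    \sum_(0 <= j < n.+1) - (F (w t j.+1) - F (w t j) - (w t j.+1 - w t j) * f (w t j)).
  rewrite sumrN sumrB tel sub0r opprK mulrCA; congr (_ * _).
  by rewrite /D mulr_sumr; apply: eq_bigr => j _; rewrite wS mulrA.
have om0 : 0 < normc (om - 1) by rewrite normc_gt0.
have tom0 : 0 < t * normc (om - 1) by rewrite mulr_gt0.
rewrite -/D -(ler_pM2l tom0).
have -> : t * normc (om - 1) * normc (n.+1%:R^-1 * D) = normc (t%:C%C * (om - 1) * (n.+1%:R^-1 * D)).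
  by rewrite [RHS]normcM [normc (_ * (om - 1))]normcM normc_real gtr0_norm.
rewrite E; apply: le_normc_mean => j _; rewrite normcN.
apply: le_trans (dP _ _ (wr _ _ t01) (wr _ _ t01) _) _.
  rewrite wSn; case/andP: t01 => _ t1.
  apply: (@le_lt_trans _ _ (d / 2)); last by lra.
  apply: le_trans hom; rewrite mulrAC; apply: ler_piMl; first exact: normc_ge0.
  exact: mulr_ile1 (ltW tp) (ltW r0) t1 r1.
rewrite wSn (_ : e / r * _ = t * normc (om - 1) * e)//.
by field; rewrite gt_eqF.
Qed.

End CircleMean.

(** * Holomorphy of the derivative *)

Section HolomorphicDerivative.
Context {R : realType}.
Implicit Types (f g h F : R[i] -> R[i]) (z w a : R[i]) (r rho e t : R).

Lemma cderiv_unique f z l m : cderiv f z l -> cderiv f z m -> l = m.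
Proof.
move=> hl hm; apply/eqP; rewrite -subr_eq0 -normc_eq0 eq_le normc_ge0 andbT.
apply/ler_addgt0Pr => e e0; rewrite add0r; have e2 : 0 < e / 2 by lra.
have [d1 d10 h1] := hl _ e2; have [d2 d20 h2] := hm _ e2.
pose t := Num.min d1 d2 / 2.
have m0 : 0 < Num.min d1 d2 by rewrite lt_min d10.
have t0 : 0 < t by rewrite /t; lra.
have tn : normc (z + t%:C%C - z) = t by rewrite addrC addKr normc_real gtr0_norm.
have [t1 t2] : t < d1 /\ t < d2.
  have : t < Num.min d1 d2 by rewrite /t; lra.
  by rewrite lt_min => /andP[].
have := h1 (z + t%:C%C); have := h2 (z + t%:C%C); rewrite tn => /(_ t2) k2 /(_ t1) k1.
rewrite -(ler_pM2l t0) -{1}(gtr0_norm t0) -normc_real -normcM.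
rewrite (_ : t%:C%C * (l - m) = (f (z + t%:C%C) - f z - (z + t%:C%C - z) * m) -
  (f (z + t%:C%C) - f z - (z + t%:C%C - z) * l)); last by ring.
by apply: le_trans (le_normcB _ _) _; lra.
Qed.

Lemma cderivZ f z l c : cderiv f z l -> cderiv (fun w => c * f w) z (c * l).
Proof.
move=> hl e e0; have c0 : 0 < normc c + 1 by rewrite ltr_wpDl// normc_ge0.
have [d d0 h] := hl _ (divr_gt0 e0 c0); exists d => // w /h hw.
rewrite [X in normc X](_ : _ = c * (f w - f z - (w - z) * l)); last by ring.
rewrite normcM; apply: le_trans (ler_wpM2l (normc_ge0 _) hw) _.
rewrite mulrA ler_wpM2r ?normc_ge0// mulrCA ger_pMr// ler_pdivrMr// mul1r lerDl//.
Qed.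

Lemma cderivD f g z l m : cderiv f z l -> cderiv g z m ->
  cderiv (fun w => f w + g w) z (l + m).
Proof.
move=> hl hm e e0; have e2 : 0 < e / 2 by lra.
have [d1 d10 h1] := hl _ e2; have [d2 d20 h2] := hm _ e2.
exists (Num.min d1 d2); first by rewrite lt_min d10.
move=> w; rewrite lt_min => /andP[/h1 s1 /h2 s2].
rewrite [X in normc X](_ : _ = (f w - f z - (w - z) * l) +
  (g w - g z - (w - z) * m)); last by ring.
by apply: le_trans (le_normcD _ _) _; lra.
Qed.

Lemma cderivMX f z l : cderiv f z l -> cderiv (fun w => w * f w) z (z * l + f z).
Proof.
move=> hl e e0; have c0 : 0 < 2 * (normc z + 1) by rewrite mulr_gt0// ltr_wpDl// normc_ge0.
have [d d0 h] := hl _ (divr_gt0 e0 c0).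
have l0 : 0 < 2 * (normc l + 1) by rewrite mulr_gt0// ltr_wpDl// normc_ge0.
exists (Num.min (Num.min d 1) (e / (2 * (normc l + 1)))).
  by rewrite !lt_min d0 ltr01 divr_gt0.
move=> w; rewrite !lt_min => /andP[/andP[/h hw w1]].
rewrite ltr_pdivlMr// => wl.
rewrite [X in normc X](_ : _ = w * (f w - f z - (w - z) * l) + (w - z) * ((w - z) * l)); last by ring.
apply: le_trans (le_normcD _ _) _; rewrite !(normcM (w - z)) normcM.
have wz : normc w <= normc z + 1 by have := lerB_normc w z; lra.
have h1 : normc w * normc (f w - f z - (w - z) * l) <= e / 2 * normc (w - z).
  have -> : e / 2 * normc (w - z) = (normc z + 1) * (e / (2 * (normc z + 1)) * normc (w - z)).
    by field; rewrite gt_eqF// ltr_wpDl// normc_ge0.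
  by apply: ler_pM; rewrite ?normc_ge0.
have h2 : normc (w - z) * (normc (w - z) * normc l) <= normc (w - z) * (e / 2).
  apply: ler_wpM2l; first exact: normc_ge0.
  have := normc_ge0 (w - z); lra.
lra.
Qed.

(** Meant for [u = (z - a)^-1], [v = (z - b)^-1] and [h = b - a], where [v - u = h * u * v]: a
    second-order Taylor estimate for the kernel powers, uniform in [z]. *)
Lemma inverse_power_taylor k : exists2 C : R, 0 <= C & forall (u v h : R[i]) (B : R),
  normc u <= B -> normc v <= B -> v - u = h * u * v ->
  normc (v ^+ k - u ^+ k - h * (k%:R * u ^+ k.+1)) <= C * normc h ^+ 2 * B ^+ k.+2.
Proof.
elim: k => [|k [C C0 IH]].
  by exists 0 => // u v h B _ _ _; rewrite !mul0r !expr0 mulr0 !subrr normc0.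
exists (C + k.+1%:R); first by rewrite addr_ge0.
move=> u v h B uB vB uv; have B0 : 0 <= B by apply: le_trans uB; exact: normc_ge0.
have -> : v ^+ k.+1 - u ^+ k.+1 - h * (k.+1%:R * u ^+ k.+2) =
    v * (v ^+ k - u ^+ k - h * (k%:R * u ^+ k.+1)) +
    k.+1%:R * (h ^+ 2 * (u ^+ k.+2 * v)).
  apply/eqP; rewrite -subr_eq0; apply/eqP.
  rewrite (_ : _ - _ = (v - u - h * u * v) * (u ^+ k + k.+1%:R * h * u ^+ k.+1)).
    by rewrite uv subrr mul0r.
  by rewrite -natr1 !exprS; ring.
apply: le_trans (le_normcD _ _) _.
have h1 : normc (v * (v ^+ k - u ^+ k - h * (k%:R * u ^+ k.+1))) <=
    B * (C * normc h ^+ 2 * B ^+ k.+2).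
  by rewrite normcM; apply: ler_pM; rewrite ?normc_ge0// IH.
have h2 : normc (k.+1%:R * (h ^+ 2 * (u ^+ k.+2 * v))) <=
    k.+1%:R * (normc h ^+ 2 * (B ^+ k.+2 * B)).
  rewrite normcM normc_nat (normcM (h ^+ 2)) (normcM (u ^+ k.+2)) !normcX.
  apply: ler_wpM2l => //.
  apply: ler_wpM2l; first by rewrite exprn_ge0// normc_ge0.
  by apply: ler_pM; rewrite ?exprn_ge0 ?normc_ge0//; apply: lerXn2r; rewrite ?nnegrE ?normc_ge0.
apply: le_trans (lerD h1 h2) _.
by rewrite le_eqVlt; apply/orP; left; apply/eqP; rewrite (exprSr B k.+2); ring.
Qed.

(** For holomorphic [F] and [k >= 1] its limit in [n] is the derivative of order [k - 1] of [F] at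
    [a], divided by [(k - 1)!]. *)
Definition cauchy_transform k F r a n : R[i] :=
  circle_mean n (fun z => F z * (z * (z - a)^-1 ^+ k)) r.

(** The Taylor estimate [main] is uniform in the number of nodes. So the transforms of order [k.+1]
    stay close to a difference quotient, of fixed small step, of the convergent transforms of order
    [k], and are therefore Cauchy; passing to the limit in [main] gives the derivative. *)
Lemma cauchy_transform_deriv k F r (M : R) g : (0 < k)%N -> 0 < r ->
  (forall z, normc z = r -> normc (F z) <= M) ->
  (forall a, normc a < r -> lims (cauchy_transform k F r a) (g a)) ->
  forall a, normc a < r -> exists l,
    lims (cauchy_transform k.+1 F r a) l /\ cderiv g a (k%:R * l).
Proof.
move=> k0 r0 FM gP a ar; have [C C0 CP] := inverse_power_taylor k.
(* Half the distance to the circle: for [b] within [dl] of [a], both kernels are bounded by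
   [dl^-1]. *)
pose dl := (r - normc a) / 2; have dl0 : 0 < dl by rewrite /dl; lra.
have M0 : 0 <= M.
  by apply: le_trans (FM r%:C%C _); rewrite ?normc_ge0// normc_real gtr0_norm.
pose K := M * (r * (C * dl^-1 ^+ k.+2)).
have K0 : 0 <= K.
  apply: mulr_ge0 => //; apply: mulr_ge0; first exact: ltW.
  by apply: mulr_ge0 => //; rewrite exprn_ge0// invr_ge0 ltW.
have main b n : normc (b - a) < dl ->
    normc (cauchy_transform k F r b n - cauchy_transform k F r a n -
      (b - a) * (k%:R * cauchy_transform k.+1 F r a n)) <= K * normc (b - a) ^+ 2.
  move=> bd.
  have -> : cauchy_transform k F r b n - cauchy_transform k F r a n -
      (b - a) * (k%:R * cauchy_transform k.+1 F r a n) =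
      circle_mean n (fun z => F z * (z * ((z - b)^-1 ^+ k - (z - a)^-1 ^+ k -
        (b - a) * (k%:R * (z - a)^-1 ^+ k.+1)))) r.
    rewrite /cauchy_transform -!circle_meanZ -!circle_meanB; apply: eq_circle_mean.
      exact: ltW.
    by move=> z _; ring.
  apply: le_circle_mean; first exact: ltW.
  move=> z zr; rewrite 2!normcM zr.
  have br : normc b < r by have := lerB_normc b a; rewrite /dl in bd; lra.
  have [_ za ua] := cauchy_kernel_bound ar zr; have [_ zb ub] := cauchy_kernel_bound br zr.
  have -> : K * normc (b - a) ^+ 2 = M * (r * (C * normc (b - a) ^+ 2 * dl^-1 ^+ k.+2)).
    by rewrite /K; ring.
  apply: ler_pM; rewrite ?mulr_ge0 ?normc_ge0 ?(ltW r0) ?FM//.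
  apply: ler_wpM2l; first exact: ltW.
  apply: CP; last by field; rewrite za zb.
    by apply: le_trans ua _; rewrite lef_pV2 ?posrE /dl; lra.
  apply: le_trans ub _; rewrite lef_pV2 ?posrE; last 2 first.
  - lra.
  - exact: dl0.
  by have := lerB_normc b a; rewrite /dl in bd *; lra.
have [l lP] : exists l, lims (cauchy_transform k.+1 F r a) l.
  apply: cauchy_lims => e e0.
  (* Two Taylor errors of at most [t * e / 4] and four convergence errors of at most [t * e / 8] add
     up to [t * e]; the step [t] is then cancelled. *)
  pose t := Num.min (dl / 2) (e / (4 * (K + 1))).
  have K4 : 0 < 4 * (K + 1) by lra.
  have t0 : 0 < t by rewrite lt_min divr_gt0//= divr_gt0.
  have td : t < dl.
    by apply: (@le_lt_trans _ _ (dl / 2)); [rewrite ge_min lexx|lra].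
  have tK : t * (4 * (K + 1)) <= e by rewrite -ler_pdivlMr// ge_min lexx orbT.
  have Kt2 : K * t ^+ 2 <= t * e / 4.
    have Kt : K * t <= e / 4 by lra.
    by rewrite expr2 mulrA mulrC -mulrA ler_pM2l.
  pose b := a + t%:C%C.
  have bn : normc (b - a) = t by rewrite /b addrC addKr normc_real gtr0_norm.
  have br : normc b < r by have := lerB_normc b a; rewrite bn /dl in td *; lra.
  have te : 0 < t * e / 8 by rewrite divr_gt0// mulr_gt0.
  have [n0 h0] := gP _ ar _ te; have [n1 h1] := gP _ br _ te.
  exists (maxn n0 n1) => n m; rewrite !geq_max => /andP[/h0 an /h1 bn'] /andP[/h0 am /h1 bm].
  have hn := main b n; have hm := main b m; rewrite bn in hn hm.
  have {}hn := hn td; have {}hm := hm td.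
  move: hn hm an am bn' bm.
  move: (cauchy_transform k.+1 F r a n) (cauchy_transform k.+1 F r a m) => Wn Wm.
  move: (cauchy_transform k F r a n) (cauchy_transform k F r a m) => An Am.
  move: (cauchy_transform k F r b n) (cauchy_transform k F r b m) => Bn Bm.
  move=> hn hm an am bn' bm.
  have k1 : 1 <= k%:R :> R by rewrite ler1n.
  have kt : t <= k%:R * t by rewrite ler_peMl// ltW.
  rewrite -(ler_pM2l t0); apply: (@le_trans _ _ (k%:R * t * normc (Wn - Wm))).
    by rewrite ler_wpM2r// normc_ge0.
  rewrite (_ : k%:R * t * normc (Wn - Wm) = normc ((b - a) * (k%:R * (Wn - Wm)))); last first.
    by rewrite !normcM normc_nat bn; ring.
  rewrite (_ : _ * (_ * _) = ((Bm - Am - (b - a) * (k%:R * Wm)) - (Bn - An - (b - a) * (k%:R * Wn)))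
    + (((Bn - g b) - (An - g a)) - ((Bm - g b) - (Am - g a)))); last by ring.
  apply: le_trans (le_normcD _ _) _.
  have s1 := le_normcB (Bm - Am - (b - a) * (k%:R * Wm)) (Bn - An - (b - a) * (k%:R * Wn)).
  have s2 := le_normcB ((Bn - g b) - (An - g a)) ((Bm - g b) - (Am - g a)).
  have s3 := le_normcB (Bn - g b) (An - g a). have s4 := le_normcB (Bm - g b) (Am - g a).
  lra.
exists l; split=> // e e0; pose d := Num.min dl (e / (K + 1)).
have K1 : 0 < K + 1 by lra.
exists d; first by rewrite lt_min dl0 divr_gt0.
move=> b; rewrite lt_min => /andP[bd]; rewrite ltr_pdivlMr// => be.
have br : normc b < r by have := lerB_normc b a; rewrite /dl in bd; lra.
apply: (@le_trans _ _ (K * normc (b - a) ^+ 2)); last first.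
  rewrite expr2 mulrA ler_wpM2r ?normc_ge0//; have := normc_ge0 (b - a); lra.
have L := limsB (limsB (gP b br) (gP a ar)) (limsZ (b - a) (limsZ k%:R lP)).
by apply: (lims_norm_le (n1 := 0%N) L) => n _; exact: main.
Qed.

(* The primitive of f is C^1, hence is reproduced by the discrete Cauchy formula,
   which can then be differentiated three times. *)
Lemma holomorphic_deriv f f' : (forall z, normc z < 1 -> cderiv f z (f' z)) ->
  forall a, normc a < 1 -> exists l, cderiv f' a l.
Proof.
move=> fD a a1; have a0 := normc_ge0 a.
(* The radii trisect the gap between [normc a] and 1: the primitive lives inside [r'], the means are
   taken on the circle of radius [r]. *)
pose r := (2 * normc a + 1) / 3; pose r' := (normc a + 2) / 3.
have r0 : 0 < r by rewrite /r; lra.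
have ar : normc a < r by rewrite /r; lra.
have rr' : r < r' by rewrite /r /r'; lra.
have r'1 : r' < 1 by rewrite /r'; lra.
have [|F FD] := holomorphic_primitive (lt_trans r0 rr') r'1 (lexx 1) (f := f).
  by move=> z z1; exists (f' z); exact: fD.
have fC z : normc z < r' -> ccont f z.
  by move=> zr; apply: cderiv_cont (fD z _); exact: lt_trans r'1.
have FC z : normc z <= r -> ccont F z.
  by move=> zr; apply: cderiv_cont (FD z _); exact: le_lt_trans rr'.
have r1 : r <= 1 by rewrite ltW// (lt_trans rr').
have [|M M0 MP] := disk_ccont_bounded _ FC; first by rewrite r0.
have FM z : normc z = r -> normc (F z) <= M by move=> zr; apply: MP; rewrite zr.
have in1 b : normc b < r -> normc b < 1 by move=> br; exact: lt_le_trans r1.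
have L1 b : normc b < r -> lims (cauchy_transform 1 F r b) (F b).
  by move=> br; have := cauchy_mean r0 rr' r1 br FD fC.
have L2 b : normc b < r -> lims (cauchy_transform 2 F r b) (f b).
  move=> br; have [l [ll]] := cauchy_transform_deriv (isT : (0 < 1)%N) r0 FM L1 br.
  rewrite mul1r => /cderiv_unique lf; rewrite -(lf (f b))//.
  by apply: FD; exact: lt_trans rr'.
have L3 b : normc b < r -> lims (cauchy_transform 3 F r b) (2^-1 * f' b).
  move=> br; have [l [ll]] := cauchy_transform_deriv (isT : (0 < 2)%N) r0 FM L2 br.
  by move=> /cderiv_unique /(_ (fD b (in1 b br))) <-; rewrite mulKf ?pnatr_eq0.
have [l [_ lP]] := cauchy_transform_deriv (isT : (0 < 3)%N) r0 FM L3 ar.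
exists (2 * (3 * l)); have := cderivZ 2 lP.
rewrite (_ : (fun w => _) = f')//; apply/funext => w.
by rewrite mulVKf// pnatr_eq0.
Qed.

End HolomorphicDerivative.

(** * Taylor coefficients as limits of means *)

Section TaylorCoefficients.
Context {R : realType}.
Implicit Types (f g h F : R[i] -> R[i]) (z w a : R[i]) (r rho e t : R).

(** Carrying all derivatives along as a sequence lets multiplication by [z] and rotations act by
    explicit formulas. *)
Definition tower (f : nat -> R[i] -> R[i]) :=
  forall k z, normc z < 1 -> cderiv (f k) z (f k.+1 z).

Lemma tower_ccont (f : nat -> R[i] -> R[i]) k z : tower f -> normc z < 1 -> ccont (f k) z.
Proof. by move=> fT z1; apply: cderiv_cont (fT k z z1). Qed.

Lemma tower_bounded (f : nat -> R[i] -> R[i]) k r : tower f -> 0 < r < 1 ->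
  exists2 M, 0 <= M & forall z, normc z <= r -> normc (f k z) <= M.
Proof.
move=> fT /andP[r0 r1]; apply: disk_ccont_bounded; first by rewrite r0 ltW.
by move=> z zr; apply: tower_ccont => //; exact: le_lt_trans r1.
Qed.

Lemma lims_unity_rootX i : lims (fun n => unity_root n ^+ i) (1 : R[i]).
Proof.
elim: i => [|i IH]; first exact: (lims_cst 1).
have h : lims (fun n => unity_root n - 1 : R[i]) 0.
  move=> e e0; have [n0 n0P] := @unity_root_near1 R _ e0.
  by exists n0 => n hn; rewrite subr0 n0P.
have b n : normc (unity_root n ^+ i : R[i]) <= 1 by rewrite normc_unity_rootX.
have := limsD (lims_mul0 b h) IH; rewrite add0r.
by apply: (@eq_lims _ _ _ _ 0%N) => n _; rewrite exprSr; ring.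
Qed.

(* Summation by parts around the circle: the mean of (F / z^k)' z vanishes in the limit. *)
Lemma lims_mean_parts F f rho r k : 0 < r -> r < rho -> r <= 1 ->
  (forall z, normc z < rho -> cderiv F z (f z)) ->
  (forall z, normc z < rho -> ccont f z) ->
  lims (fun n => (\sum_(0 <= i < k) unity_root n ^+ i) *
      circle_mean n (fun z => F z / z ^+ k) r -
    circle_mean n (fun z => f z * z / z ^+ k) r) 0.
Proof.
move=> r0 rr r1 FD fC e e0.
have rk0 : 0 < r ^+ k by rewrite exprn_gt0.
have [d d0 dP] := unif_cderiv r0 rr r1 (mulr_gt0 e0 rk0) FD fC.
have d2 : 0 < d / 2 by lra.
have [n0 n0P] := @unity_root_near1 R _ d2.
exists (maxn n0 1) => n; rewrite geq_max => /andP[/n0P hom n1]; rewrite subr0.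
set om := unity_root n in hom *; pose zj j := circle_pt n r j.
have zr j : normc (zj j) = r by rewrite normc_circle_pt// ltW.
have zn0 j : zj j != 0 by rewrite -normc_gt0 zr.
have om1 : om - 1 != 0 by rewrite subr_eq0 -[om]expr1 unity_rootX_neq1.
have om0 : 0 < normc (om - 1) by rewrite normc_gt0.
have zS j : zj j.+1 = zj j * om by exact: circle_ptS.
have zSn j : normc (zj j.+1 - zj j) = r * normc (om - 1).
  by rewrite zS -{2}[zj j]mulr1 -mulrBr normcM zr.
pose S := \sum_(0 <= j < n.+1) F (zj j) / zj j ^+ k.
(* Moving the index by one node replaces [zj j ^- k] by [om ^+ k] times [zj j.+1 ^- k]; the
   resulting [om ^+ k - 1] contains the geometric sum times [om - 1]. *)
have shift : \sum_(0 <= j < n.+1) F (zj j.+1) / zj j ^+ k = om ^+ k * S.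
  rewrite /S -(circle_mean_sum_shift n r (fun z => F z / z ^+ k)) mulr_sumr.
  apply: eq_bigr => j _; rewrite -/(zj j.+1) mulrCA; congr (_ * _).
  by rewrite zS (exprMn _ (zj j)) invfM mulrCA divff ?mulr1// expf_neq0// unity_root_neq0.
set X := _ - _.
have E : (om - 1) * X = n.+1%:R^-1 * \sum_(0 <= j < n.+1)
    (F (zj j.+1) - F (zj j) - (zj j.+1 - zj j) * f (zj j)) / zj j ^+ k.
  rewrite /X /circle_mean -/S mulrBr mulrA big_mkord -subrX1.
  rewrite [RHS](_ : _ = n.+1%:R^-1 * (om ^+ k * S - S -
    (om - 1) * \sum_(0 <= j < n.+1) f (zj j) * zj j / zj j ^+ k)); first by ring.
  congr (_ * _); rewrite -shift mulr_sumr -!sumrB; apply: eq_bigr => j _.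
  by rewrite zS; ring.
rewrite -(ler_pM2l om0) -normcM E; apply: le_normc_mean => j _.
rewrite normcM normcV normcX zr ler_pdivrMr//.
apply: le_trans (dP _ _ _ _ _) _; rewrite ?zr ?zSn//.
  apply: (@le_lt_trans _ _ (d / 2)); last by lra.
  by apply: le_trans hom; apply: ler_piMl; rewrite ?normc_ge0.
rewrite [leRHS](_ : _ = e * r ^+ k * normc (om - 1)); last by ring.
apply: ler_wpM2l; first by rewrite mulr_ge0 ?ltW.
by apply: ler_piMl; rewrite ?normc_ge0.
Qed.

(** Induction over all towers: summation by parts relates coefficient [k.+1] of [f], multiplied by
    [k.+1], to coefficient [k] of the derivative. The base case is Cauchy's formula at 0. *)
Lemma tower_coef (f : nat -> R[i] -> R[i]) k r : tower f -> 0 < r < 1 ->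
  lims (fun n => circle_mean n (fun z => f 0 z / z ^+ k) r) (f k 0 / k`!%:R).
Proof.
move=> fT rr; have /andP[r0 r1] := rr.
elim: k f fT => [|k IH] f fT.
  rewrite fact0 divr1.
  have := @cauchy_mean _ (f 0) (f 1) 1 r 0 r0 r1 (ltW r1).
  rewrite normc0 => /(_ r0 (fT 0) (fun z => @tower_ccont f 1 z fT)).
  apply: (@eq_lims _ _ _ _ 0%N) => n _; apply: eq_circle_mean; first exact: ltW.
  move=> z zr; rewrite subr0 expr0 divr1 divff ?mulr1//.
  by rewrite -normc_gt0 zr.
have fT' : tower (fun i => f i.+1) by move=> i z; exact: fT.
have {}IH := IH _ fT'.
have P := lims_mean_parts k.+1 r0 r1 (ltW r1) (fT 0) (fun z => @tower_ccont f 1 z fT).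
(* The geometric sum tends to [k.+1]; as the mean of [f 0 z / z ^+ k.+1] is so far only known to be
   bounded, the replacement costs a bounded factor times a null sequence. *)
have Sk : lims (fun n => k.+1%:R - \sum_(0 <= i < k.+1) unity_root n ^+ i : R[i]) 0.
  have := limsB (lims_cst k.+1%:R) (lims_sum (index_iota 0 k.+1) lims_unity_rootX).
  by rewrite sumr_const_nat subn0 subrr.
have [M M0 MP] := tower_bounded 0 fT rr.
have mb n : normc (circle_mean n (fun z => f 0 z / z ^+ k.+1) r) <= M / r ^+ k.+1.
  apply: le_circle_mean; first exact: ltW.
  move=> z zr; rewrite normcM normcV normcX zr ler_wpM2r//.
    by rewrite invr_ge0 exprn_ge0// ltW.
  by rewrite MP// zr.
have := limsZ k.+1%:R^-1 (limsD (limsD P IH) (lims_mul0 mb Sk)).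
rewrite add0r addr0 [f k.+1 0 / k.+1`!%:R](_ : _ = k.+1%:R^-1 * (f k.+1 0 / k`!%:R)); last first.
  by rewrite factS natrM invfM; ring.
apply: (@eq_lims _ _ _ _ 0%N) => n _.
have -> : circle_mean n (fun z => f 1 z * z / z ^+ k.+1) r = circle_mean n (fun z => f 1 z / z ^+ k) r.
  apply: eq_circle_mean; first exact: ltW.
  move=> z zr; have z0 : z != 0 by rewrite -normc_gt0 zr.
  by rewrite exprSr; field; rewrite z0 expf_neq0.
by rewrite subrK [X in _ * (X + _)]mulrC -mulrDr addrC subrK mulrC mulfK ?natS_neq0.
Qed.

(** Leibniz' rule for [z * f]; at [k = 0] the meaningless [k.-1] is multiplied by 0. *)
Lemma tower_mulX (f : nat -> R[i] -> R[i]) : tower f ->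
  tower (fun k z => z * f k z + k%:R * f k.-1 z).
Proof.
move=> fT k z z1; case: k => [|k] /=.
  have := cderivD (cderivMX (fT 0%N z z1)) (cderivZ 0 (fT 0%N z z1)).
  by rewrite mul0r addr0 mul1r.
have := cderivD (cderivMX (fT k.+1 z z1)) (cderivZ k.+1%:R (fT k z z1)).
by rewrite -addrA -[k.+2%:R]natr1 mulrDl mul1r [f k.+1 z + _]addrC.
Qed.

Lemma tower_mulXn (f : nat -> R[i] -> R[i]) p : tower f ->
  exists2 g, tower g & forall z, g 0%N z = z ^+ p * f 0%N z.
Proof.
move=> fT; elim: p => [|p [g gT gE]]; first by exists f => // z; rewrite mul1r.
exists (fun k z => z * g k z + k%:R * g k.-1 z); first exact: tower_mulX.
by move=> z; rewrite mul0r addr0 gE exprS mulrA.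
Qed.

(** [z ^+ p * f] is again a tower, and its means tend to its value at 0. *)
Lemma tower_negcoef (f : nat -> R[i] -> R[i]) p r : tower f -> 0 < r < 1 -> (0 < p)%N ->
  lims (fun n => circle_mean n (fun z => f 0%N z * z ^+ p) r) 0.
Proof.
move=> fT r01 p0; have [g gT gE] := tower_mulXn p fT.
have := tower_coef 0 gT r01; rewrite gE expr0n gtn_eqF// !mul0r.
apply: (@eq_lims _ _ _ _ 0%N) => n _; apply: eq_circle_mean; first by case/andP: r01 => /ltW.
by move=> z _; rewrite gE divr1 mulrC.
Qed.

(** The kernel is expanded to order [K] under the mean: its terms yield the Taylor polynomial in the
    limit, its remainder the geometric error. *)
Lemma tower_taylor (f : nat -> R[i] -> R[i]) r a : tower f -> 0 < r < 1 -> normc a < r ->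
  exists C : R, forall K,
    normc (f 0%N a - \sum_(0 <= i < K) f i 0 / i`!%:R * a ^+ i) <= C * (normc a / r) ^+ K.
Proof.
move=> fT r01 ar; have /andP[r0 r1] := r01.
have [M M0 MP] := tower_bounded 0 fT r01.
exists (M * (r * (r - normc a)^-1)) => K.
have A := cauchy_mean r0 r1 (ltW r1) ar (fT 0%N) (fun z => @tower_ccont f 1 z fT).
have B : lims (fun n => \sum_(i <- index_iota 0 K)
    (a ^+ i * circle_mean n (fun z => f 0%N z / z ^+ i) r))
    (\sum_(0 <= i < K) a ^+ i * (f i 0 / i`!%:R)).
  by apply: lims_sum => i; apply: limsZ; exact: tower_coef.
have -> : \sum_(0 <= i < K) f i 0 / i`!%:R * a ^+ i =
    \sum_(0 <= i < K) a ^+ i * (f i 0 / i`!%:R).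
  by apply: eq_bigr => i _; rewrite mulrC.
apply: (lims_norm_le (n1 := 0%N) (limsB A B)) => n _.
have -> : circle_mean n (fun z => f 0%N z * (z / (z - a))) r -
    \sum_(0 <= i < K) a ^+ i * circle_mean n (fun z => f 0%N z / z ^+ i) r =
    circle_mean n (fun z => f 0%N z * (a ^+ K / z ^+ K * (z / (z - a)))) r.
  under eq_bigr do rewrite -circle_meanZ.
  rewrite -circle_mean_sum -circle_meanB; apply: eq_circle_mean; first exact: ltW.
  move=> z zr; have [z0 za _] := cauchy_kernel_bound ar zr.
  rewrite {1}(geometric_expansion K z0 za) mulrDr mulr_sumr addrAC -sumrB.
  rewrite big1 ?add0r// => i _.
  by rewrite mulrCA subrr.
apply: le_circle_mean; first exact: ltW.
move=> z zr; have [_ _ zb] := cauchy_kernel_bound ar zr.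
rewrite normcM -[leRHS]mulrA; apply: ler_pM; rewrite ?normc_ge0//; first by rewrite MP// zr.
rewrite 2!normcM normcV !normcX zr -expr_div_n mulrC.
apply: ler_wpM2r; first by rewrite exprn_ge0// divr_ge0 ?normc_ge0// ltW.
by rewrite normcM zr ler_pM2l.
Qed.

End TaylorCoefficients.

(** * Inequalities between coefficients of bounded holomorphic functions *)

Section CoefficientInequalities.
Context {R : realType}.
Implicit Types (f g h : R[i] -> R[i]) (z w a : R[i]) (r e t : R).

(** Passage to the boundary [r = 1], by Bernoulli's inequality for [(1 - s) ^+ k]. *)
Lemma le_of_le_expr_near1 (x y : R) k : 0 <= x ->
  (forall r, 0 < r < 1 -> x * r ^+ k <= y) -> x <= y.
Proof.
move=> x0 h; apply: (@le_epsM _ _ _ (x * k%:R)); first by rewrite mulr_ge0.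
move=> e e0; pose s := Num.min e 2^-1.
have s0 : 0 < s by rewrite lt_min e0; lra.
have s1 : s <= 2^-1 by rewrite ge_min lexx orbT.
have se : s <= e by rewrite ge_min lexx.
have bern j : 1 - j%:R * s <= (1 - s) ^+ j.
  elim: j => [|j IH]; first by rewrite mul0r subr0.
  have s2 : 0 <= 1 - s by lra.
  rewrite exprS -natr1; have := ler_wpM2l s2 IH.
  have : 0 <= j%:R * s * s by rewrite !mulr_ge0// ltW.
  lra.
have s01 : 0 < 1 - s < 1 by lra.
have h1 := h _ s01; have h2 := ler_wpM2l x0 (bern k).
have h3 : x * k%:R * s <= x * k%:R * e by rewrite ler_wpM2l// mulr_ge0.
lra.
Qed.

Lemma normc_circle_mean_le n h r :
  normc (circle_mean n h r) <= n.+1%:R^-1 * \sum_(0 <= j < n.+1) normc (h (circle_pt n r j)).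
Proof.
by rewrite normcM normcV normc_nat ler_wpM2l ?invr_ge0// le_normc_sum.
Qed.

Lemma circle_mean_real n h (x : R[i] -> R) r : 0 <= r ->
  (forall z, normc z = r -> h z = (x z)%:C%C) ->
  circle_mean n h r = (n.+1%:R^-1 * \sum_(0 <= j < n.+1) x (circle_pt n r j))%:C%C.
Proof.
move=> r0 hx; rewrite rmorphM fmorphV rmorph_nat rmorph_sum; congr (_ * _).
by apply: eq_bigr => j _; rewrite hx// normc_circle_pt.
Qed.

Lemma circle_mean_div n r i k : 0 < r -> i != k -> (i < n.+1)%N -> (k < n.+1)%N ->
  circle_mean n (fun z => z ^+ k / z ^+ i) r = 0.
Proof.
move=> r0 ik ni nk; have z0 z : normc z = r -> z != 0 by move=> zr; rewrite -normc_gt0 zr.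
have [lt|lt|eq] := ltngtP i k; last by rewrite eq eqxx in ik.
- rewrite (@eq_circle_mean _ _ _ _ (fun z => z ^+ (k - i))) ?(ltW r0)//.
    by apply: circle_mean_expr; rewrite subn_gt0 lt (leq_ltn_trans (leq_subr _ _)).
  move=> z /z0 zn0; rewrite -{1}(subnK (ltnW lt)) exprD mulfK// expf_neq0//.
- rewrite (@eq_circle_mean _ _ _ _ (fun z => z ^- (i - k))) ?(ltW r0)//.
    by apply: circle_mean_exprV; rewrite subn_gt0 lt (leq_ltn_trans (leq_subr _ _)).
  move=> z /z0 zn0; rewrite -{1}(subnK (ltnW lt)) exprD invfM mulrCA divff ?mulr1//.
  by rewrite expf_neq0.
Qed.

Lemma mulc_conjc z : z * z^*%C = (normc z ^+ 2)%:C%C.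
Proof. by rewrite -sqr_normc rmorphXn. Qed.

Lemma normc_conjc z : normc (z^*%C) = normc z.
Proof. by case: z => x y /=; rewrite sqrrN. Qed.

(** On the circle a conjugate power is a multiple of an inverse power, so pairing with it is a
    coefficient mean. *)
Lemma conjc_expr_circle z r k : 0 < r -> normc z = r ->
  (z ^+ k)^*%C = (r ^+ (2 * k))%:C%C / z ^+ k.
Proof.
move=> r0 zr; have zk : z ^+ k != 0 by rewrite expf_neq0// -normc_gt0 zr.
by apply: (mulfI zk); rewrite mulc_conjc normcX zr mulrC divfK// -exprM mulnC.
Qed.

(** [g] is tested against its own two terms [T = P z^i + Q z^k]: both the mean of [g] times the
    conjugate of [T] and the mean of [|T|^2] yield [S]. *)
Lemma coef_bessel (g : nat -> R[i] -> R[i]) (M : R) i k : tower g -> i != k ->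
  (forall z, normc z < 1 -> normc (g 0%N z) <= M) ->
  normc (g i 0 / i`!%:R) ^+ 2 + normc (g k 0 / k`!%:R) ^+ 2 <= M ^+ 2.
Proof.
move=> gT ik gM; set P := g i 0 / _; set Q := g k 0 / _.
apply: (@le_of_le_expr_near1 _ _ (2 * (i + k))); first by rewrite addr_ge0// sqr_ge0.
move=> r r01; have /andP[r0 r1] := r01.
pose S := r ^+ (2 * i) * normc P ^+ 2 + r ^+ (2 * k) * normc Q ^+ 2.
have SM : S <= M ^+ 2; last first.
  apply: le_trans SM; rewrite mulrC mulrDr mulnDr exprD.
  have re j : 0 <= r ^+ j <= 1 by rewrite exprn_ge0 ?(ltW r0)//= exprn_ile1 ?(ltW r0) ?(ltW r1).
  have /andP[i0 i1] := re (2 * i)%N; have /andP[k0 k1] := re (2 * k)%N.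
  apply: lerD; apply: ler_wpM2r; rewrite ?sqr_ge0//; [exact: ler_piMr|exact: ler_piMl].
have S0 : 0 <= S by rewrite addr_ge0// mulr_ge0 ?sqr_ge0// exprn_ge0// ltW.
pose T z := P * z ^+ i + Q * z ^+ k.
have TE z : normc z = r -> (T z)^*%C =
    (r ^+ (2 * i))%:C%C * P^*%C / z ^+ i + (r ^+ (2 * k))%:C%C * Q^*%C / z ^+ k.
  move=> zr; rewrite /T rmorphD !rmorphM /= !(conjc_expr_circle _ r0 zr); ring.
have meanT h n : circle_mean n (fun z => h z * (T z)^*%C) r =
    (r ^+ (2 * i))%:C%C * P^*%C * circle_mean n (fun z => h z / z ^+ i) r +
    (r ^+ (2 * k))%:C%C * Q^*%C * circle_mean n (fun z => h z / z ^+ k) r.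
  rewrite -!circle_meanZ -circle_meanD; apply: eq_circle_mean; first exact: ltW.
  by move=> z zr; rewrite TE//; ring.
have SE : (r ^+ (2 * i))%:C%C * P^*%C * P + (r ^+ (2 * k))%:C%C * Q^*%C * Q = S%:C%C.
  by rewrite -!mulrA ![_^*%C * _]mulrC !mulc_conjc -!rmorphM -rmorphD.
have TT n : (i + k <= n)%N -> n.+1%:R^-1 * \sum_(0 <= j < n.+1) normc (T (circle_pt n r j)) ^+ 2 = S.
  move=> hn; apply: (@complexI R).
  rewrite -(@circle_mean_real n (fun z => T z * (T z)^*%C) (fun z => normc (T z) ^+ 2)) ?(ltW r0)//.
    have ni : (i < n.+1)%N by rewrite ltnS (leq_trans _ hn)// leq_addr.
    have nk : (k < n.+1)%N by rewrite ltnS (leq_trans _ hn)// leq_addl.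
    rewrite meanT -SE; congr (_ * _ + _ * _).
      rewrite (@eq_circle_mean _ _ _ _ (fun z => P + Q * (z ^+ k / z ^+ i))) ?(ltW r0)//.
        by rewrite circle_meanD circle_mean_cst circle_meanZ circle_mean_div// mulr0 addr0.
      move=> z zr; rewrite /T mulrDl mulfK -?mulrA// expf_neq0//.
      by rewrite -normc_gt0 zr.
    rewrite (@eq_circle_mean _ _ _ _ (fun z => P * (z ^+ i / z ^+ k) + Q)) ?(ltW r0)//.
      by rewrite circle_meanD circle_mean_cst circle_meanZ circle_mean_div 1?eq_sym// mulr0 add0r.
    move=> z zr; rewrite /T mulrDl mulfK -?mulrA// expf_neq0//.
    by rewrite -normc_gt0 zr.
  by move=> z _; exact: mulc_conjc.
have L : lims (fun n => circle_mean n (fun z => g 0%N z * (T z)^*%C) r) S%:C%C.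
  rewrite -SE; have := limsD (limsZ ((r ^+ (2 * i))%:C%C * P^*%C) (tower_coef i gT r01))
    (limsZ ((r ^+ (2 * k))%:C%C * Q^*%C) (tower_coef k gT r01)).
  by apply: (@eq_lims _ _ _ _ 0%N) => n _; rewrite meanT.
(* The inequality [2 M |T| <= M^2 + |T|^2] replaces Cauchy-Schwarz; [S <= (M ^+ 2 + S) / 2] amounts
   to [S <= M ^+ 2]. *)
suff : normc S%:C%C <= (M ^+ 2 + S) / 2 by rewrite normc_real ger0_norm//; lra.
apply: (lims_norm_le (n1 := (i + k)%N) L) => n hn.
apply: le_trans (normc_circle_mean_le _ _ _) _.
have -> : (M ^+ 2 + S) / 2 = n.+1%:R^-1 * \sum_(0 <= j < n.+1)
    ((M ^+ 2 + normc (T (circle_pt n r j)) ^+ 2) / 2).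
  rewrite -mulr_suml big_split sumr_const_nat subn0 mulrA mulrDr -(TT n hn) -[M ^+ 2 *+ _]mulr_natl.
  by rewrite mulKf// pnatr_eq0.
apply: ler_wpM2l; first by rewrite invr_ge0.
apply: ler_sum => j _; set z := circle_pt _ _ _.
have zr : normc z = r by rewrite normc_circle_pt// ltW.
have gz : normc (g 0%N z) <= M by apply: gM; rewrite zr.
rewrite normcM normc_conjc.
have m0 := normc_ge0 (g 0%N z).
have h1 : normc (g 0%N z) * normc (T z) <= M * normc (T z) by rewrite ler_wpM2r ?normc_ge0.
apply: le_trans h1 _; have := sqr_ge0 (M - normc (T z)); rewrite sqrrB -mulr_natr; lra.
Qed.

(** The value 1 at 0 keeps the modulus equal to 1 in all cases. *)
Definition phase z : R[i] := if z == 0 then 1 else z / (normc z)%:C%C.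

Lemma normc_phase z : normc (phase z) = 1.
Proof.
rewrite /phase; case: eqVneq => [_|z0]; first exact: normc1.
by rewrite normcM normcV normc_real ger0_norm ?normc_ge0// divff// normc_eq0.
Qed.

Lemma phaseE z : z = (normc z)%:C%C * phase z.
Proof.
rewrite /phase; case: eqVneq => [->|z0]; first by rewrite normc0 mul0r.
by rewrite mulrC divfK// -normc_eq0 normc_real normr_eq0 normc_eq0.
Qed.

(** With [u^-1] in place of the conjugate, the weight becomes a Laurent polynomial in [z], whose
    mean against [g] is a combination of coefficients. *)
Lemma unit_weight (u : R[i]) : normc u = 1 ->
  1 + 2^-1 * (u + u^-1) = (1 + complex.Re u)%:C%C /\ 0 <= 1 + complex.Re u.
Proof.
move=> u1; have u0 : u != 0 by rewrite -normc_gt0 u1.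
have -> : u^-1 = u^*%C.
  by apply: (mulfI u0); rewrite mulc_conjc u1 expr1n divff.
have := le_trans (normc_Re u) (_ : _ <= 1); rewrite u1 ler_norml => /(_ (lexx 1)) h.
split; last by lra.
rewrite rmorphD rmorph1; congr (_ + _).
apply: (mulfI (_ : 2 != 0)); first by rewrite pnatr_eq0.
rewrite mulVKf ?pnatr_eq0//; case: (u) => x y; apply/eqP.
by rewrite eq_complex mulr_natl mulr2n /= subrr addr0 !eqxx.
Qed.

(* Testing g against the nonnegative weight 1 + Re u, with u of frequency n - k. *)
Lemma coef_weight (g : nat -> R[i] -> R[i]) (M : R) n k : tower g -> (n < k)%N ->
  (forall z, normc z < 1 -> normc (g 0%N z) <= M) ->
  (forall j, (j < n)%N -> g j 0 = 0) ->
  normc (g n 0 / n`!%:R) + 2^-1 * normc (g k 0 / k`!%:R) <= M.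
Proof.
move=> gT nk gM g0; set P := g n 0 / _; set Q := g k 0 / _.
apply: (@le_of_le_expr_near1 _ _ k).
  by rewrite addr_ge0 ?mulr_ge0 ?normc_ge0 ?invr_ge0.
move=> r r01; have /andP[r0 r1] := r01.
pose m := (k - n)%N; have m0 : (0 < m)%N by rewrite subn_gt0.
have km : k = (m + n)%N by rewrite subnK// ltnW.
(* This choice gives [P] and [b * Q] the same argument, so that their moduli add. *)
pose b : R[i] := phase P / phase Q.
have b1 : normc b = 1 by rewrite normcM normcV !normc_phase invr1 mulr1.
have b0 : b != 0 by rewrite -normc_gt0 b1.
have rC0 : (r%:C%C : R[i]) != 0 by rewrite -normc_gt0 normc_real gtr0_norm.
pose u z : R[i] := b * r%:C%C ^+ m / z ^+ m.
have z0 z : normc z = r -> z != 0 by move=> zr; rewrite -normc_gt0 zr.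
have u1 z : normc z = r -> normc (u z) = 1.
  move=> zr; rewrite 2!normcM normcV !normcX zr b1 mul1r normc_real gtr0_norm//.
  by rewrite divff// expf_neq0// gt_eqF.
pose W z := 1 + 2^-1 * (u z + (u z)^-1).
have WE z : normc z = r -> W z = 1 + (2^-1 * (b * r%:C%C ^+ m)) * z ^- m +
    (2^-1 * (b * r%:C%C ^+ m)^-1) * z ^+ m.
  move=> zr; rewrite /W /u; move: (b * r%:C%C ^+ m) => A.
  by rewrite invfM invrK mulrDr !mulrA addrA.
have mW N : (m < N.+1)%N -> circle_mean N W r = 1.
  move=> mN; rewrite (eq_circle_mean N (ltW r0) WE) !circle_meanD !circle_meanZ.
  by rewrite circle_mean_cst circle_mean_expr ?circle_mean_exprV ?m0// !mulr0 !addr0.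
(* The other frequency of the weight picks the coefficient of index [n - m]: it vanishes by [g0] if
   [m <= n], and by holomorphy if the index is negative. *)
have neg : lims (fun N => circle_mean N (fun z => g 0%N z / z ^+ n * z ^+ m) r) 0.
  have [mn|nm|mn] := ltngtP m n.
  - have := tower_coef (n - m) gT r01; rewrite g0 ?mul0r; last first.
      by rewrite ltn_subrL m0 (leq_ltn_trans _ mn).
    apply: (@eq_lims _ _ _ _ 0%N) => N _; apply: eq_circle_mean; first exact: ltW.
    move=> z /z0 zn; rewrite -{2}(subnK (ltnW mn)) exprD invfM -!mulrA mulVf ?mulr1//.
    by rewrite expf_neq0.
  - have := @tower_negcoef _ g (m - n) r gT r01; rewrite subn_gt0 => /(_ nm).
    apply: (@eq_lims _ _ _ _ 0%N) => N _; apply: eq_circle_mean; first exact: ltW.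
    move=> z /z0 zn; rewrite -{2}(subnKC (ltnW nm)) exprD mulrA divfK//.
    by rewrite expf_neq0.
  - have := tower_coef 0 gT r01; rewrite g0 ?mul0r -?mn//.
    apply: (@eq_lims _ _ _ _ 0%N) => N _; apply: eq_circle_mean; first exact: ltW.
    by move=> z /z0 zn; rewrite mn divfK ?expf_neq0// divr1.
have L : lims (fun N => circle_mean N (fun z => g 0%N z / z ^+ n * W z) r)
    (P + 2^-1 * (b * r%:C%C ^+ m) * Q + 2^-1 * (b * r%:C%C ^+ m)^-1 * 0).
  have := limsD (limsD (tower_coef n gT r01)
    (limsZ (2^-1 * (b * r%:C%C ^+ m)) (tower_coef k gT r01)))
    (limsZ (2^-1 * (b * r%:C%C ^+ m)^-1) neg).
  apply: (@eq_lims _ _ _ _ 0%N) => N _.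
  rewrite -!circle_meanZ -!circle_meanD; apply: eq_circle_mean; first exact: ltW.
  by move=> z zr; rewrite WE// km exprD invfM; ring.
have ev : forall N, (m <= N)%N ->
    normc (circle_mean N (fun z => g 0%N z / z ^+ n * W z) r) <= M / r ^+ n.
  move=> N mN; apply: le_trans (normc_circle_mean_le _ _ _) _.
  have M0 : 0 <= M / r ^+ n.
    rewrite divr_ge0 ?exprn_ge0 ?(ltW r0)//; apply: le_trans (gM 0 _); rewrite ?normc_ge0//.
    by rewrite normc0.
  pose x z := 1 + complex.Re (u z).
  have xE z : normc z = r -> W z = (x z)%:C%C by move=> /u1 /unit_weight[].
  have x0 z : normc z = r -> 0 <= x z by move=> /u1 /unit_weight[].
  have X1 : N.+1%:R^-1 * \sum_(0 <= j < N.+1) x (circle_pt N r j) = 1.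
    by apply: (@complexI R); rewrite -(circle_mean_real N (ltW r0) xE) mW.
  rewrite [leRHS](_ : _ = N.+1%:R^-1 * (M / r ^+ n * \sum_(0 <= j < N.+1) x (circle_pt N r j))); last first.
    by rewrite mulrCA X1 mulr1.
  apply: ler_wpM2l; first by rewrite invr_ge0.
  rewrite mulr_sumr; apply: ler_sum => j _; set z := circle_pt _ _ _.
  have zr : normc z = r by rewrite normc_circle_pt// ltW.
  rewrite normcM xE// normc_real (ger0_norm (x0 _ zr)) ler_wpM2r ?x0//.
  rewrite normcM normcV normcX zr ler_wpM2r ?invr_ge0 ?exprn_ge0 ?(ltW r0)//.
  by apply: gM; rewrite zr.
have := lims_norm_le L ev; rewrite mulr0 addr0.
have -> : P + 2^-1 * (b * r%:C%C ^+ m) * Q =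
    phase P * (normc P + 2^-1 * r ^+ m * normc Q)%:C%C.
  rewrite {1}[P]phaseE {1}[Q]phaseE !(rmorphD, rmorphM, rmorphXn) fmorphV rmorph_nat /= /b.
  have q0 : phase Q != 0 by rewrite -normc_gt0 normc_phase.
  by field; rewrite q0.
rewrite normcM normc_phase mul1r normc_real ger0_norm; last first.
  by rewrite addr_ge0 ?mulr_ge0 ?normc_ge0 ?invr_ge0// exprn_ge0// ltW.
rewrite ler_pdivlMr ?exprn_gt0//; apply: le_trans.
rewrite !mulrDl; apply: lerD.
  apply: ler_wpM2l; first exact: normc_ge0.
  rewrite km exprD ler_piMl ?exprn_ge0 ?(ltW r0)// exprn_ile1 ?(ltW r0) ?(ltW r1)//.
by rewrite le_eqVlt; apply/orP; left; apply/eqP; rewrite km exprD; ring.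
Qed.

End CoefficientInequalities.

(** * Differences [f z - f (lam z)] and the extremal case *)

Section Rotation.
Context {R : realType}.
Implicit Types (f : nat -> R[i] -> R[i]) (z w a lam : R[i]).

Definition rot_diff f lam (k : nat) z : R[i] := f k z - lam ^+ k * f k (lam * z).

Lemma tower_rot_diff f lam : normc lam = 1 -> tower f -> tower (rot_diff f lam).
Proof.
move=> lam1 fT k z z1.
have lz : normc (lam * z) < 1 by rewrite normcM lam1 mul1r.
have D : cderiv (fun w => f k (lam * w)) z (lam * f k.+1 (lam * z)).
  move=> e e0; have [d d0 dP] := fT k _ lz e e0; exists d => // w wd.
  have E : lam * w - lam * z = lam * (w - z) by ring.
  have := dP (lam * w); rewrite E normcM lam1 mul1r => /(_ wd).
  by rewrite mulrCA mulrA.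
have := cderivD (fT k z z1) (cderivZ (- lam ^+ k) D).
rewrite /rot_diff (_ : _ + _ = f k.+1 z - lam ^+ k.+1 * f k.+1 (lam * z)).
  by under eq_fun do rewrite mulNr.
by rewrite exprSr; ring.
Qed.

Lemma rot_diff_coef f lam k :
  rot_diff f lam k 0 / k`!%:R = (1 - lam ^+ k) * (f k 0 / k`!%:R).
Proof. by rewrite /rot_diff mulr0; ring. Qed.

Lemma normc_rot_diff_coef f lam k : normc (rot_diff f lam k 0 / k`!%:R) =
  normc (1 - lam ^+ k) * normc (f k 0 / k`!%:R).
Proof. by rewrite rot_diff_coef normcM. Qed.

Lemma normc_rot_diff_le f (d : R) lam z : normc lam = 1 ->
  (forall z w, normc z < 1 -> normc w < 1 -> normc (f 0%N z - f 0%N w) <= d) ->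
  normc z < 1 -> normc (rot_diff f lam 0 z) <= d.
Proof. by move=> l1 fd z1; rewrite /rot_diff mul1r; apply: fd; rewrite ?normcM ?l1 ?mul1r. Qed.

(* An n-th root of - e^(2is). *)
Definition twist n (s : R) : R[i] := cis (pi / n%:R + (s / n%:R) *+ 2).

Lemma normc_twist n s : normc (twist n s) = 1.
Proof. exact: normc_cis. Qed.

Lemma twistX n s k : twist n s ^+ k = cis (pi / n%:R *+ k) * cis ((s / n%:R *+ k) *+ 2).
Proof. by rewrite cisX mulrnDl mulrnAC cisD. Qed.

Lemma twistXn n s : (0 < n)%N -> 1 - twist n s ^+ n = 1 + cis (s *+ 2).
Proof.
move=> n0; have nn0 : (n%:R : R) != 0 by rewrite pnatr_eq0 -lt0n.
rewrite twistX -[pi / _ *+ n]mulr_natr -[s / _ *+ n]mulr_natr !divfK//.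
by rewrite cispi mulN1r opprK.
Qed.

Lemma normc_twist_coef f n s : (0 < n)%N ->
  normc (rot_diff f (twist n s) n 0 / n`!%:R) = 2 * `|cos s| * normc (f n 0 / n`!%:R).
Proof. by move=> n0; rewrite normc_rot_diff_coef twistXn// normc_cisD1. Qed.

Lemma coef_le_half_diam f (d : R) n : tower f -> (0 < n)%N ->
  (forall z w, normc z < 1 -> normc w < 1 -> normc (f 0%N z - f 0%N w) <= d) ->
  normc (f n 0 / n`!%:R) <= d / 2.
Proof.
move=> fT n0 fd; have l1 := normc_twist n 0.
have z1 : normc (0 : R[i]) < 1 by rewrite normc0.
have d0 : 0 <= d by apply: le_trans (fd _ _ z1 z1); exact: normc_ge0.
(* Cauchy's estimate as Bessel's inequality for the indices [n] and 0, the second square being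
   dropped. *)
have := coef_bessel (tower_rot_diff l1 fT) (lt0n_neq0 n0)
  (fun z => normc_rot_diff_le (z := z) l1 fd).
rewrite normc_twist_coef// cos0 normr1 mulr1 => h.
have : 2 * normc (f n 0 / n`!%:R) <= d; last by lra.
rewrite -(ler_pXn2r (isT : (0 < 2)%N)) ?nnegrE ?mulr_ge0 ?normc_ge0//.
by apply: le_trans h; rewrite lerDl sqr_ge0.
Qed.

Lemma low_coef_eq0 f (d : R) n k : tower f -> (0 < k < n)%N ->
  (forall z w, normc z < 1 -> normc w < 1 -> normc (f 0%N z - f 0%N w) <= d) ->
  normc (f n 0 / n`!%:R) = d / 2 -> f k 0 / k`!%:R = 0.
Proof.
move=> fT /andP[k0 kn] fd eqd; have n0 := ltn_trans k0 kn.
have l1 := normc_twist n 0.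
have nk : n != k by rewrite gtn_eqF.
have := coef_bessel (tower_rot_diff l1 fT) nk
  (fun z => normc_rot_diff_le (z := z) l1 fd).
rewrite normc_twist_coef// cos0 normr1 mulr1 eqd [2 * _]mulrC divfK ?pnatr_eq0// => h.
have /eqP : normc (rot_diff f (twist n 0) k 0 / k`!%:R) ^+ 2 = 0.
  by apply/eqP; rewrite eq_le sqr_ge0 andbT; lra.
rewrite sqrf_eq0 normc_eq0 rot_diff_coef mulf_eq0 => /orP[|/eqP//].
have nR : (0 : R) < n%:R by rewrite ltr0n.
(* The angle [pi * k / n] lies strictly between 0 and [pi], so [lam ^+ k] is not 1. *)
rewrite subr_eq0 eq_sym twistX mul0r mul0rn mul0rn cis0 mulr1 (negPf (cis_neq1 _))//.
rewrite -[_ *+ k]mulr_natr mulr_gt0 ?divr_gt0 ?ltr0n ?pi_gt0//=.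
apply: (@lt_trans _ _ pi); last by rewrite mulr2n ltrDl pi_gt0.
by rewrite mulrAC ltr_pdivrMr// ltr_pM2l ?pi_gt0// ltr_nat.
Qed.

Lemma high_coef_eq0 f (d : R) n k : tower f -> (0 < n < k)%N ->
  (forall z w, normc z < 1 -> normc w < 1 -> normc (f 0%N z - f 0%N w) <= d) ->
  normc (f n 0 / n`!%:R) = d / 2 -> f k 0 / k`!%:R = 0.
Proof.
move=> fT /andP[n0 nk] fd eqd.
have key s : d * `|cos s| + 2^-1 * (normc (1 - twist n s ^+ k) * normc (f k 0 / k`!%:R)) <= d.
  have l1 := normc_twist n s.
  have := coef_weight (tower_rot_diff l1 fT) nk (fun z => normc_rot_diff_le (z := z) l1 fd).
  rewrite normc_twist_coef// normc_rot_diff_coef eqd.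
  have -> : 2 * `|cos s| * (d / 2) = d * `|cos s| by field.
  (* The constant term cancels in the difference; the coefficients between 0 and [n] vanish because
     they do for [f]. *)
  apply=> j jn; have [->|j0] := posnP j; first by rewrite /rot_diff mulr0 mul1r subrr.
  have jn' : (0 < j < n)%N by rewrite j0.
  have /eqP := low_coef_eq0 fT jn' fd eqd.
  rewrite mulf_eq0 invr_eq0 pnatr_eq0 gtn_eqF ?fact_gt0// orbF => /eqP h.
  by rewrite /rot_diff mulr0 h mulr0 subr0.
have c0 := normc_ge0 (f k 0 / k`!%:R).
apply/eqP; rewrite -normc_eq0 eq_le c0 andbT.
(* If the unperturbed [lam ^+ k] is not 1, then [s = 0] settles the matter; otherwise
   [normc (1 - lam ^+ k)] is [2 * sin (s * k / n)] for the small [s] chosen below. *)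
have [mu1|mu1] := eqVneq (cis (pi / n%:R *+ k)) (1 : R[i]); last first.
  have := key 0; rewrite cos0 normr1 mulr1 twistX mul0r mul0rn mul0rn cis0 mulr1 => h.
  have m0 : 0 < normc (1 - cis (pi / n%:R *+ k) : R[i]) by rewrite normc_gt0 subr_eq0 eq_sym.
  by rewrite -(ler_pM2l m0) mulr0; lra.
have d0 : 0 <= d.
  have z1 : normc (0 : R[i]) < 1 by rewrite normc0.
  by apply: le_trans (fd _ _ z1 z1); exact: normc_ge0.
apply: (le_epsM d0) => e e0; rewrite add0r.
have p0 := @pi_gt0 R.
have nR : (0 : R) < n%:R by rewrite ltr0n.
have kR : (0 : R) < k%:R by rewrite ltr0n (ltn_trans n0).
have nkR : (n%:R : R) < k%:R by rewrite ltr_nat.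
have : {for 0, continuous (@sin R)} by exact: continuous_sin.
move=> /cvgrPdist_le /(_ _ e0)[del del0 delP].
have del1 : 0 < del by exact: del0.
(* The first bound makes [sin s] at most [e]; the second keeps [s * k / n] within [pi / 2], where
   the sine increases. *)
pose s := Num.min (del / 2) (pi / 2 * (n%:R / k%:R)).
have s0 : 0 < s by rewrite lt_min !mulr_gt0 ?invr_gt0.
have sdel : s < del by apply: (@le_lt_trans _ _ (del / 2)); [rewrite ge_min lexx|lra].
have sk : s / n%:R *+ k <= pi / 2.
  rewrite -[_ *+ k]mulr_natr mulrAC ler_pdivrMr// -ler_pdivlMr// -mulrA.
  by rewrite ge_min lexx orbT.
have ss : s < s / n%:R *+ k by rewrite -[_ *+ k]mulr_natr mulrAC ltr_pdivlMr// ltr_pM2l.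
have sins : 0 < sin s by apply: sin_gt0_pi; lra.
have sine : sin s <= e.
  have := delP s; rewrite /= sin0 !sub0r !normrN !gtr0_norm//; exact.
have mono : sin s <= sin (s / n%:R *+ k).
  by rewrite ltW// ltr_sin// in_itv /=; lra.
have cs : 0 <= cos s <= 1 by rewrite cos_le1 cos_ge0_pihalf//; lra.
have := key s; rewrite twistX mu1 mul1r normcBC normc_cisB1.
rewrite (ger0_norm (ltW (lt_le_trans sins mono))) ger0_norm; last by case/andP: cs.
move=> h.
have h1 : normc (f k 0 / k`!%:R) * sin s <= d * (1 - cos s).
  have := ler_wpM2l c0 mono; lra.
(* For [0 <= cos s <= 1], [1 - cos s] is at most [1 - cos s ^+ 2]; one of the two factors [sin s] is
   then cancelled against the left side. *)
have h2 : d * (1 - cos s) <= d * (sin s * sin s).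
  apply: ler_wpM2l => //; rewrite -expr2 sin2cos2 expr2.
  have : cos s * cos s <= cos s by case/andP: cs => c1 c2; exact: ler_piMl.
  lra.
have h3 : normc (f k 0 / k`!%:R) <= d * sin s.
  by rewrite -(ler_pM2r sins) -mulrA; exact: le_trans h2.
by apply: le_trans h3 _; rewrite mulrC ler_wpM2r.
Qed.

Lemma extremal_monomial f (d : R) n : tower f -> (0 < n)%N ->
  (forall z w, normc z < 1 -> normc w < 1 -> normc (f 0%N z - f 0%N w) <= d) ->
  normc (f n 0 / n`!%:R) = d / 2 ->
  forall a, normc a < 1 -> f 0%N a = f 0%N 0 + f n 0 / n`!%:R * a ^+ n.
Proof.
move=> fT n0 fd eqd a a1; have a0 := normc_ge0 a.
pose r := (normc a + 1) / 2.
have ar : normc a < r by rewrite /r; lra.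
have r01 : 0 < r < 1 by rewrite /r; lra.
have [C CP] := tower_taylor fT r01 ar.
pose q := normc a / r.
have q01 : 0 <= q < 1.
  by case/andP: r01 => r0 _; rewrite /q divr_ge0 ?(ltW r0)//= ltr_pdivrMr// mul1r.
have sumE K : (n < K)%N -> \sum_(0 <= i < K) f i 0 / i`!%:R * a ^+ i =
    f 0%N 0 + f n 0 / n`!%:R * a ^+ n.
  move=> nK; rewrite big_mkord (bigD1 (Ordinal (ltn_trans n0 nK)))//= divr1 mulr1.
  congr (_ + _); rewrite (bigD1 (Ordinal nK)) /=; last by rewrite -val_eqE /= gtn_eqF.
  rewrite big1 ?addr0// => i /andP[]; rewrite -!val_eqE /= => i0 ni.
  have -> : f i 0 / i`!%:R = 0; last by rewrite mul0r.
  have [lt|lt|eq] := ltngtP i n; last by rewrite eq eqxx in ni.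
  - by apply: low_coef_eq0 fT _ fd eqd; rewrite lt0n i0.
  - by apply: high_coef_eq0 fT _ fd eqd; rewrite n0.
apply/eqP; rewrite -subr_eq0 -normc_eq0 eq_le normc_ge0 andbT.
have C0 : 0 <= `|C| by [].
apply: (le_epsM C0) => e e0; rewrite add0r.
have [N NP] := lims_expr0 q01 e0.
have := CP (maxn N n.+1); rewrite sumE ?leq_maxr// => h.
apply: le_trans h _; rewrite -/q.
have h1 := NP (maxn N n.+1) (leq_maxl _ _).
have q0 : 0 <= q ^+ maxn N n.+1 by rewrite exprn_ge0//; case/andP: q01.
apply: (@le_trans _ _ (`|C| * q ^+ maxn N n.+1)); first by rewrite ler_wpM2r// ler_norm.
by rewrite mulrC ler_wpM2r.
Qed.

(** The coefficient means of a monomial plus a constant equal [c] exactly once there are more than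
    [n] nodes, so uniqueness of limits replaces iterated differentiation. *)
Lemma monomial_coef f (c : R[i]) n : tower f -> (0 < n)%N ->
  (forall z, normc z < 1 -> f 0%N z = f 0%N 0 + c * z ^+ n) -> f n 0 / n`!%:R = c.
Proof.
move=> fT n0 fE; have h01 : 0 < (2^-1 : R) < 1 by lra.
apply: (lims_unique (tower_coef n fT h01)).
apply: (@eq_lims _ (fun=> c) _ _ n) (lims_cst c) => N nN.
rewrite (@eq_circle_mean _ N _ _ (fun z => f 0%N 0 * z ^- n + c)); last 2 first.
- by rewrite invr_ge0.
- move=> z zr; have z1 : normc z < 1 by rewrite zr; case/andP: h01.
  by rewrite (fE z z1) mulrDl mulfK// expf_neq0// -normc_gt0 zr invr_gt0.
rewrite circle_meanD circle_meanZ circle_mean_cst circle_mean_exprV ?n0 ?ltnS//.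
by rewrite mulr0 add0r.
Qed.

End Rotation.

(** * Analytic functions on the disk as towers, and the theorem *)

Section Analytic.
Context {R : realType}.
Implicit Types (f : Cplx R -> Cplx R) (z : Cplx R).

Lemma derivable_cderiv f z : derivable f z 1 -> cderiv f z (derive1 f z).
Proof.
move=> df e e0; have eC : 0 < e%:C%C :> Cplx R by rewrite ltcR.
have [d d0 dP] := derivable_eps df eC.
(* A positive element of [Cplx R] has zero imaginary part, so a real radius can be extracted. *)
have [dE dp] : d = (complex.Re d)%:C%C /\ 0 < complex.Re d.
  by case: d d0 {dP} => x y; rewrite ltcE /= => /andP[/eqP -> ?].
exists (complex.Re d) => // w wd; have := dP w; rewrite dE.
have nE (x : Cplx R) : `|x| = (normc x)%:C%C :> Cplx R by [].
by rewrite !nE ltcR -rmorphM lecR; apply.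
Qed.

Lemma cderiv_derivable f z l : cderiv f z l -> derivable f z 1 /\ derive1 f z = l.
Proof.
move=> fl; apply: eps_derivable => e e0.
have [eE ep] : e = (complex.Re e)%:C%C /\ 0 < complex.Re e.
  by case: e e0 => x y; rewrite ltcE /= => /andP[/eqP -> ?].
have [d d0 dP] := fl _ ep; exists d%:C%C; first by rewrite ltcR.
have nE (x : Cplx R) : `|x| = (normc x)%:C%C :> Cplx R by [].
by move=> w; rewrite eE !nE ltcR -rmorphM lecR => /dP.
Qed.

Lemma analytic_tower f : analytic_on f (unit_disk R) -> tower (fun k => nth_deriv k f).
Proof.
move=> fA; suff D k z : normc z < 1 -> derivable (nth_deriv k f) z 1.
  by move=> k z z1; apply: derivable_cderiv; exact: D.
elim: k z => [|k IH] z z1; first exact: fA.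
have [l lP] := @holomorphic_deriv R (nth_deriv k f) (nth_deriv k.+1 f)
  (fun w w1 => derivable_cderiv (IH w w1)) z z1.
by have [] := cderiv_derivable lP.
Qed.

End Analytic.

Theorem theorem7 (R : realType) (f : Cplx R -> Cplx R)
  (hf : analytic_on f (unit_disk R)) (n : nat) (hn : (0 < n)%N) :
  ((normc (nth_deriv n f 0) / n`!%:R)%:E
     <= Diam (f @` unit_disk R) * (2^-1)%:E)%E /\
  ((normc (nth_deriv n f 0) / n`!%:R)%:E
     = (Diam (f @` unit_disk R) * (2^-1)%:E)%E
   <-> exists c : Cplx R,
         (forall z, unit_disk R z -> f z = f 0 + c * z ^+ n) /\
         (normc c)%:E = (Diam (f @` unit_disk R) * (2^-1)%:E)%E).
Proof.
have fT := analytic_tower hf.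
have z1 : normc (0 : R[i]) < 1 by rewrite normc0.
have hnorm : normc (nth_deriv n f 0) / n`!%:R = normc (nth_deriv n f 0 / n`!%:R).
  by rewrite normcM normcV normc_nat.
rewrite hnorm.
have D0 : (0 <= Diam (f @` unit_disk R))%E.
  apply: ereal_sup_ubound; exists (f 0); first by exists 0.
  by exists (f 0); [exists 0|rewrite subrr [normc _]normc0].
have Dub z w : unit_disk R z -> unit_disk R w ->
    ((normc (f z - f w))%:E <= Diam (f @` unit_disk R))%E.
  move=> hz hw; apply: ereal_sup_ubound; exists (f z); first by exists z.
  by exists (f w) => //; exists w.
case: (Diam (f @` unit_disk R)) D0 Dub => [d| |//] d0 Dub; last first.
  (* Infinite diameter: the inequality is trivial, and both sides of the equivalence fail because
     moduli are finite. *)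
  rewrite gt0_mulye ?lte_fin ?invr_gt0//; split; first by rewrite leey.
  by split=> // -[c []].
have fd z w : normc z < 1 -> normc w < 1 -> normc (nth_deriv 0 f z - nth_deriv 0 f w) <= d.
  by move=> hz hw; rewrite -lee_fin; exact: Dub.
rewrite -EFinM; split; first by rewrite lee_fin; exact: (coef_le_half_diam fT hn fd).
split=> [[eqd]|[c [fE [cE]]]].
  exists (nth_deriv n f 0 / n`!%:R); split; last by rewrite eqd.
  by move=> z hz; exact: (extremal_monomial fT hn fd eqd hz).
by rewrite (monomial_coef fT hn fE) cE.
Qed.
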